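(* Let $m$ be a non-trivial $\sigma$-finite Borel measure on $D$. Assume that (IR$_m$) for every $f\in B_b^+(D)$ with $\int_Df\,dm>0$ we have $R^D_1f(x)>0$ for all $x\in D$, and that for some (thus all) $\alpha\ge0$ we have $mR^D_\alpha\ll m$. Then for each $\alpha\ge0$ there exist an $(\alpha+1)$-excessive function $\psi^\alpha_D:D\to(0,+\infty)$ and a $\sigma$-finite Borel measure $\nu^\alpha_D$ on $D$ satisfying $m\ll\nu^\alpha_D$ such that the minorization condition $M(\alpha,\psi^\alpha_D,\nu^\alpha_D)$ holds, i.e. $$R^D_\alpha f(x)\ge\psi^\alpha_D(x)\int_Df\,d\nu^\alpha_D,\qquad x\in D,\ f\in B_b^+(D).$$
   Context: Setting and standing assumptions. $D\subset\mathbb R^d$ is a domain (open connected set). $B_b^+(E)$ denotes the non-negative bounded Borel functions on $E$; $\mu\ll\nu$ means absolute continuity. $A$ is the operator $$Au(x)=\tfrac12\mathrm{Tr}(\mathbf Q(x)\nabla^2u(x))+b(x)\cdot\nabla u(x)+\int_{\mathbb R^d}\Big(u(x+y)-u(x)-\frac{y\cdot\nabla u(x)}{1+|y|^2}\Big)N(x,dy).$$ (A1) The entries of the symmetric non-negative definite matrix $\mathbf Q(x)$ and of the vector $b(x)$ are bounded Borel functions on $\mathbb R^d$. (A2) $N(x,dy)$ is a kernel of $\sigma$-finite Borel measures on $\mathbb R^d\setminus\{0\}$ with $\sup_x\int\min\{1,|y|^2\}N(x,dy)<\infty$. (A4) There is a strong Markovian solution $(P_x)_{x\in\mathbb R^d}$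 of the martingale problem for $A$, which is fixed: Borel probability measures on the Skorokhod space of càdlàg paths $[0,\infty)\to\mathbb R^d$ with canonical process $X_t$ and natural filtration $(\mathcal F_t)$, such that $P_x(X_0=x)=1$; for each $f\in C_b^2(\mathbb R^d)$ the process $f(X_t)-f(X_0)-\int_0^tAf(X_r)dr$ is a $P_x$-martingale; $x\mapsto P_x[C]$ is measurable for Borel $C$; $X$ is strong Markov; and $P_\mu=\int P_x\,\mu(dx)$ solves the martingale problem with initial law $\mu$ for every Borel probability measure $\mu$. $\mathbb E_x$ is expectation under $P_x$. Let $\tau_D=\inf\{t>0:X_t\notin D\}$. (ET) $P_x(\tau_D<\infty)=1$ for all $x\in D$. Semigroup and resolvent: $P^D_tf(x)=\mathbb E_x[f(X_t);\,t<\tau_D]$, $R^D_\alpha f(x)=\int_0^\infty e^{-\alpha t}P^D_tf(x)\,dt$ for $\alpha\ge0$. For a Borel measure $m$ on $D$, $mR^D_\alpha(B)=\int_DR^D_\alpha\mathbf 1_B\,dm$. A Borel function $f:D\to[0,\infty)$ is $\beta$-excessive if $P^D_tf\le e^{\beta t}f$ for all $t\ge0$ and $\lim_{t\to0+}P^D_tf(x)=f(x)$ for all $x\in D$. *)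

(* Defs.v *)
From HB Require Import structures.
From mathcomp Require Import all_boot all_order all_algebra.
From mathcomp Require Import all_classical all_reals all_analysis.

Set Implicit Arguments.
Unset Strict Implicit.
Unset Printing Implicit Defensive.

Import Order.TTheory GRing.Theory Num.Theory.
Import numFieldTopology.Exports numFieldNormedType.Exports.

Local Open Scope classical_set_scope.
Local Open Scope ring_scope.

(** * Borel structure of R^d *)

Section borel_matrix.
Context {R : realType} {m n : nat}.
Let G : set (set 'M[R]_(m, n)) := @open 'M[R]_(m, n).

HB.instance Definition _ := @isMeasurable.Build (sigma_display G) 'M[R]_(m, n)
  <<s G >> (@sigma_algebra0 _ setT G) (@sigma_algebraC _ G)
  (@sigma_algebra_bigcup _ setT G).

End borel_matrix.

(** * Cadlag paths *)

Section paths.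
Context {R : realType} {d : nat}.
Local Notation E := 'rV[R]_d.

(** A path on the time axis [0, +oo) is encoded by its unique extension to R
    that is constant on (-oo, 0]. *)
Definition cadlag (X : R -> E) : Prop :=
  [/\ right_continuous X,
      forall t, cvg (X s @[s --> t^'-]) &
      forall t, t < 0 -> X t = X 0].

Record cadlag_path := CadlagPath {
  path_fun :> R -> E ;
  path_cadlag : cadlag path_fun
}.

Lemma cadlag_cst (x : E) : cadlag (fun=> x).
Proof. by split=> // t; [exact: cvg_cst|exact: is_cvg_cst]. Qed.

HB.instance Definition _ := gen_eqMixin cadlag_path.
HB.instance Definition _ := gen_choiceMixin cadlag_path.
HB.instance Definition _ := isPointed.Build cadlag_path
  (CadlagPath (cadlag_cst 0)).

Definition cylinders (I : set R) : set (set cadlag_path) :=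
  [set [set w : cadlag_path | B (w s)] | s in I & B in measurable].

(** The Borel sigma-algebra of the Skorokhod topology, which is generated by
    the coordinate maps. *)
HB.instance Definition _ :=
  @isMeasurable.Build (sigma_display (cylinders `[0, +oo[)) cadlag_path
    <<s cylinders `[0, +oo[ >> (@sigma_algebra0 _ setT _) (@sigma_algebraC _ _)
    (@sigma_algebra_bigcup _ setT _).

Definition natural_filtration (t : R) : set (set cadlag_path) :=
  <<s cylinders `[0, t] >>.

Definition shift_fun (t : R) (w : R -> E) : R -> E :=
  fun s => w (t + Num.max 0 s).

Lemma cadlag_shift (t : R) (w : cadlag_path) : cadlag (shift_fun t w).
Proof.
have [wr wl _] := path_cadlag w.
have max_neg (s : R) : s < 0 -> Num.max 0 s = 0.
  by move=> s0; apply/max_idPl; exact: ltW.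
have max_pos (s : R) : 0 <= s -> Num.max 0 s = s by move=> s0; exact/max_idPr.
have addt (x : R) : t + s @[s --> x] --> t + x.
  by apply: cvgD; [exact: cvg_cst|exact: cvg_id].
split=> [x|x|x x0].
- have [x0|x0] := ltP x 0.
    rewrite /shift_fun max_neg//; apply: cvg_near_cst.
    by near=> s; rewrite max_neg//; near: s; exact: nbhs_right_lt.
  suff h : w (t + s) @[s --> x^'+] --> w (t + x).
    rewrite /shift_fun max_pos//; apply: cvg_trans h; apply: near_eq_cvg.
    near=> s; rewrite max_pos//; apply: (le_trans x0); near: s.
    exact: nbhs_right_ge.
  apply: cvg_comp (wr (t + x)) => A.
  rewrite /at_right/= => /addt tA.
  change (nbhs x (fun s => x < s -> A (t + s))).
  apply: (@filterS _ (nbhs x) _ _ _ _ tA) => s tsA xs; apply: tsA.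
  by rewrite ltrD2l.
- have [x0|x0] := leP x 0.
    apply: (@cvgP _ _ (w (t + 0))); apply: cvg_near_cst.
    near=> s; rewrite /shift_fun max_neg//; apply: lt_le_trans x0; near: s.
    exact: nbhs_left_lt.
  have /cvg_ex[/= l wlx] := wl (t + x).
  apply: (@cvgP _ _ l).
  suff h : w (t + s) @[s --> x^'-] --> l.
    rewrite /shift_fun; apply: cvg_trans h; apply: near_eq_cvg.
    by near=> s; rewrite max_pos//; near: s; exact: nbhs_left_ge.
  apply: cvg_comp wlx => A.
  rewrite /at_left/= => /addt tA.
  change (nbhs x (fun s => s < x -> A (t + s))).
  apply: (@filterS _ (nbhs x) _ _ _ _ tA) => s tsA xs; apply: tsA.
  by rewrite ltrD2l.
- by rewrite /shift_fun max_neg// maxxx.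
Unshelve. all: by end_near. Qed.

Definition shift_path (t : R) (w : cadlag_path) : cadlag_path :=
  CadlagPath (cadlag_shift t w).

End paths.
Arguments cadlag_path : clear implicits.

(** * The operator A *)

Section operator.
Context {R : realType} {d : nat}.
Local Notation E := 'rV[R]_d.
Implicit Types (u : E -> R) (x y : E).

Definition dotp x y : R := \sum_(i < d) x 0 i * y 0 i.

(** The Euclidean |y|^2; the library norm on row vectors is the sup norm. *)
Definition sqnorm y : R := dotp y y.

Definition partial_derivative (i : 'I_d) u : E -> R :=
  fun x => 'D_(delta_mx 0 i) u x.

Definition gradient u x : E := \row_i partial_derivative i u x.

Definition hessian u x : 'M[R]_d :=
  \matrix_(i, j) partial_derivative i (partial_derivative j u) x.

Definition C0b u : Prop := continuous u /\ bounded_fun u.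

Definition C1b u : Prop :=
  [/\ C0b u, forall i x, derivable u x (delta_mx 0 i) &
      forall i, C0b (partial_derivative i u)].

Definition C2b u : Prop := C1b u /\ forall i, C1b (partial_derivative i u).

Variables (Q : E -> 'M[R]_d) (b : E -> E) (N : R.-sigmafker E ~> E).

Definition levy_operator u x : R :=
  2^-1 * \tr (Q x *m hessian u x) + dotp (b x) (gradient u x) +
  \int[N x]_(y in ~` [set 0])
     (u (x + y) - u x - dotp y (gradient u x) / (1 + sqnorm y)).

Record bounded_coefficients : Prop := BoundedCoefficients {
  diffusion_measurable : forall i j, measurable_fun setT (fun x => Q x i j) ;
  diffusion_bounded : forall i j, bounded_fun (fun x => Q x i j) ;
  diffusion_sym : forall x, (Q x)^T = Q x ;
  diffusion_nonneg : forall x v, 0 <= dotp (v *m Q x) v ;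
  drift_measurable : forall i, measurable_fun setT (fun x => b x 0 i) ;
  drift_bounded : forall i, bounded_fun (fun x => b x 0 i)
}.

(** Measures on R^d \ {0} are measures on R^d that do not charge {0}. *)
Record bounded_levy_kernel : Prop := BoundedLevyKernel {
  levy_kernel0 : forall x, N x [set 0] = 0%E ;
  levy_kernel_bounded :
    (ereal_sup [set \int[N x]_y (Num.min 1 (sqnorm y))%:E | x in [set: E]]
     < +oo)%E
}.

End operator.

(** * Martingale problem and strong Markov property *)

Section martingale_problem.
Context {R : realType} {d : nat}.
Local Notation E := 'rV[R]_d.
Local Notation Omega := (cadlag_path R d).

(** Martingale for the natural filtration; the last clause is
    E[M_t | F_s] = M_s, written out since M_s is F_s-measurable. *)
Definition martingale (Pr : {measure set Omega -> \bar R})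
    (M : R -> Omega -> R) : Prop :=
  [/\ forall t, 0 <= t ->
        forall B, measurable B -> natural_filtration t (M t @^-1` B),
      forall t, 0 <= t -> Pr.-integrable setT (EFin \o M t) &
      forall s t C, 0 <= s -> s <= t -> natural_filtration s C ->
        \int[Pr]_(w in C) M t w = \int[Pr]_(w in C) M s w].

Definition mp_process (A : (E -> R) -> E -> R) (f : E -> R) (t : R)
    (w : Omega) : R :=
  f (w t) - f (w 0) - \int[@lebesgue_measure R]_(r in `[0, t]) A f (w r).

Definition solves_martingale_problem (A : (E -> R) -> E -> R)
    (mu : probability E R) (Pr : probability Omega R) : Prop :=
  (forall B, measurable B -> Pr [set w : Omega | B (w 0)] = mu B) /\
  (forall f, C2b f -> martingale Pr (mp_process A f)).

Definition stopping_time (T : Omega -> \bar R) : Prop :=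
  (forall w, (0 <= T w)%E) /\
  (forall t, 0 <= t -> natural_filtration t [set w : Omega | (T w <= t%:E)%E]).

Definition stopped_sigma_algebra (T : Omega -> \bar R) : set (set Omega) :=
  [set C | measurable C /\ forall t, 0 <= t ->
    natural_filtration t (C `&` [set w : Omega | (T w <= t%:E)%E])].

(** P_x(theta_T^-1 C | F_T) = P_(X_T)(C) on {T < +oo}, P_x-almost surely. *)
Definition strong_markov (P : R.-pker E ~> Omega) : Prop :=
  forall (T : Omega -> \bar R), stopping_time T ->
  forall x F C, stopped_sigma_algebra T F -> measurable C ->
    let F' := F `&` [set w : Omega | (T w < +oo)%E] in
    P x (F' `&` [set w : Omega | C (shift_path (fine (T w)) w)]) =
    (\int[P x]_(w in F') P (w (fine (T w))) C)%E.

Record strong_markov_solution (A : (E -> R) -> E -> R)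
    (P : R.-pker E ~> Omega) : Prop := StrongMarkovSolution {
  solution_start : forall x, P x [set w : Omega | w 0 = x] = 1%E ;
  solution_martingale :
    forall x f, C2b f -> martingale (P x) (mp_process A f) ;
  solution_strong_markov : strong_markov P ;
  solution_mixture :
    forall (mu : probability E R) (Pmu : probability Omega R),
    (forall C, measurable C -> Pmu C = (\int[mu]_x P x C)%E) ->
    solves_martingale_problem A mu Pmu
}.

End martingale_problem.

(** * The process killed on leaving D *)

Section killed_process.
Context {R : realType} {d : nat}.
Local Notation E := 'rV[R]_d.
Local Notation Omega := (cadlag_path R d).
Variables (D : set E) (P : R.-pker E ~> Omega).

Definition exit_time (w : Omega) : \bar R :=
  ereal_inf [set t%:E | t in [set t : R | 0 < t /\ ~ D (w t)]].

(** Borel measures on D are Borel measures on R^d that do not charge the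
    complement of D; functions on D are functions on R^d of which only the
    values on D matter. *)

Definition Bb_plus (f : E -> R) : Prop :=
  [/\ measurable_fun D f, forall x, D x -> 0 <= f x &
      exists c, forall x, D x -> f x <= c].

(** {t < tau_D} need not belong to the raw sigma-algebra of the path space but
    only to its P_x-completion. The library integral of a nonnegative function
    is a supremum over measurable simple minorants, so that it agrees here with
    the integral for the completion. The condition D (w t) follows from
    t < tau_D if 0 < t, and holds P_x-a.s. if t = 0 and x is in D. *)
Definition killed_semigroup (t : R) (f : E -> R) (x : E) : \bar R :=
  (\int[P x]_(w in [set w : Omega | D (w t) /\ t%:E < exit_time w])
     (f (w t))%:E)%E.

Definition resolvent (alpha : R) (f : E -> R) (x : E) : \bar R :=
  (\int[@lebesgue_measure R]_(t in `[0%R, +oo[)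
     ((expR (- alpha * t))%:E * killed_semigroup t f x))%E.

Definition measure_resolvent (m : set E -> \bar R) (alpha : R) (B : set E)
    : \bar R :=
  (\int[m]_(x in D) resolvent alpha \1_B x)%E.

Definition excessive (beta : R) (f : E -> R) : Prop :=
  [/\ measurable_fun D f, forall x, D x -> 0 <= f x,
      forall t x, 0 <= t -> D x ->
        (killed_semigroup t f x <= (expR (beta * t) * f x)%:E)%E &
      forall x, D x -> killed_semigroup t f x @[t --> 0^'+] --> (f x)%:E].

Definition minorization (alpha : R) (psi : E -> R)
    (nu : {measure set E -> \bar R}) : Prop :=
  forall f x, Bb_plus f -> D x ->
    ((psi x)%:E * \int[nu]_(y in D) (f y)%:E <= resolvent alpha f x)%E.

Definition resolvent_irreducible (m : {measure set E -> \bar R}) : Prop :=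
  forall f, Bb_plus f -> (0 < \int[m]_(x in D) (f x)%:E)%E ->
    forall x, D x -> (0 < resolvent 1 f x)%E.

End killed_process.

(* Main.v *)
(** For [beta = alpha + 1], the operator R^D_beta is integration against the
    occupation kernel U_beta of the killed process, and (IR_m) says that m is
    absolutely continuous with respect to U_beta(x, .) for every x in D. Choose a
    probability p << m. The densities of p with respect to U_beta(x, .) are jointly
    measurable because the Borel sigma-algebra is countably generated; bounding
    them off a small set yields c > 0, A and B0 with p A > 0, p B0 > 0 and
      (U_beta U_beta)(y, B) >= c * p (B :&: B0)   for y in A.
    By the Markov property U_beta U_alpha f <= U_alpha f, whence
      U_alpha f >= U_beta U_beta U_beta U_beta f >= (U_beta 1_A) * c * \int_B0 U_beta f dp,
    so that psi = U_beta 1_A and nu = c * (p restricted to B0) U_beta do; the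
    function psi is beta-excessive by the Markov property, and m << nu by (IR_m).

    The event {t < tau_D} is not Borel. It is replaced by the event that the path
    stays up to time t at a positive distance from the complement of D. The two
    differ only on paths that jump back into D from a left limit outside of D at the
    supremum of their exit times from the erosions of D. These paths form a null
    set: a test function in the martingale problem gives
    P_x(|X_t - x| > e) <= C t uniformly in x, Ottaviani's inequality extends this to
    the supremum over a short time interval, and the Markov property at the
    (discretized) exit times concludes. *)

Require Import Defs.
From HB Require Import structures.
From mathcomp Require Import all_boot all_order all_algebra.
From mathcomp Require Import all_classical all_reals all_analysis.
From mathcomp Require Import measurable_realfun ring lra.

Set Implicit Arguments.
Unset Strict Implicit.
Unset Printing Implicit Defensive.

Import Order.TTheory GRing.Theory Num.Theory.
Import numFieldTopology.Exports numFieldNormedType.Exports.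

Local Open Scope classical_set_scope.
Local Open Scope ring_scope.

(** * Mixtures and images of measures *)

(** Each of the four factors [U_beta] has its own task. The outermost makes [U_beta 1_A] positive on
    all of D and excessive. The two in the middle are needed because the set on which the density of
    p with respect to [U_beta(x, .)] is large moves with x: only after integration over an
    intermediate point does a lower bound hold on a fixed product of A and B0. The innermost spreads
    p restricted to B0 into a measure that dominates m. The rate alpha + 1 serves two ends.
    [U_alpha] may be infinite, for instance at alpha = 0, whereas [U_beta] is a finite kernel, as
    the Radon-Nikodym argument demands. And the integral of exp(-(alpha + 1) s) exp(alpha s) over s
    >= 0 is 1, which gives [U_beta U_alpha f <= U_alpha f] without the resolvent equation, hence
    without subtracting infinite values. (IR_m) speaks of the rate 1; it passes to beta because the
    discount factors are positive, so that the null sets of [U_alpha(x, .)] do not depend on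
    alpha. *)

Section mixture.
Local Open Scope ereal_scope.
Context d1 d2 (X : measurableType d1) (Y : measurableType d2) (R : realType).
Variables (mu : {measure set X -> \bar R}) (k : X -> {measure set Y -> \bar R}).
Hypothesis mk : forall B, measurable B -> measurable_fun [set: X] (k ^~ B).

(* The hypothesis is an argument so that the measure structure below is
   attached to the constant. *)
Definition mixture of (forall B, measurable B -> measurable_fun [set: X] (k ^~ B)) :=
  fun B => \int[mu]_x k x B.

Local Notation kappa := (mixture mk).

Let mixture0 : kappa set0 = 0.
Proof. by rewrite /mixture integral0_eq// => x _; rewrite measure0. Qed.

Let mixture_ge0 B : 0 <= kappa B.
Proof. exact: integral_ge0. Qed.

Let mixture_sigma_additive : semi_sigma_additive kappa.
Proof.
move=> F mF tF mUF; rewrite [X in _ --> X](_ : _ =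
    \int[mu]_x (\sum_(n <oo) k x (F n))); last first.
  apply: eq_integral => x _; apply/esym/cvg_lim => //.
  exact: measure_semi_sigma_additive.
apply/cvg_closeP; split.
  by apply: is_cvg_nneseries => n _ _; exact: integral_ge0.
by rewrite closeE// integral_nneseries// => n; exact: mk.
Qed.

HB.instance Definition _ := isMeasure.Build _ _ _
  kappa mixture0 mixture_ge0 mixture_sigma_additive.

Lemma measurable_integral_kernel (f : Y -> \bar R) :
  measurable_fun setT f -> (forall y, 0 <= f y) ->
  measurable_fun setT (fun x => \int[k x]_y f y).
Proof. by move=> mf f0; exact: measurable_fun_integral_kernel. Qed.

Import HBNNSimple.

Let integral_mixture_nnsfun (h : {nnsfun Y >-> R}) :
  \int[kappa]_y (h y)%:E = \int[mu]_x \int[k x]_y (h y)%:E.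
Proof.
under [RHS]eq_integral do rewrite integralT_nnsfun sintegralE.
rewrite integralT_nnsfun sintegralE ge0_integral_fsum//; last 2 first.
  by move=> r; apply: measurable_funeM; exact: mk.
  by move=> r x _; exact: nnsfun_mulemu_ge0.
apply: eq_fsbigr => r /set_mem[y _ hy].
by rewrite ge0_integralZl//; [exact: mk|rewrite lee_fin -hy].
Qed.

Lemma integral_mixture (f : Y -> \bar R) :
  measurable_fun setT f -> (forall y, 0 <= f y) ->
  \int[kappa]_y f y = \int[mu]_x \int[k x]_y f y.
Proof.
move=> mf f0; pose f_ := nnsfun_approx measurableT mf.
have mono (m : {measure set Y -> \bar R}) :
    \int[m]_y f y = limn (fun n => \int[m]_y (f_ n y)%:E).
  rewrite -monotone_convergence//.
  - by apply: eq_integral => y _; apply/esym/cvg_lim => //; exact: cvg_nnsfun_approx.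
  - by move=> n; exact/measurable_EFinP.
  - by move=> n y _; rewrite lee_fin.
  - by move=> y _ a b ab; rewrite lee_fin; exact/lefP/nd_nnsfun_approx.
rewrite mono; under eq_fun do rewrite integral_mixture_nnsfun.
under [RHS]eq_integral do rewrite mono.
rewrite monotone_convergence//.
- move=> n; apply: measurable_integral_kernel; first exact/measurable_EFinP.
  by move=> y; rewrite lee_fin.
- by move=> n x _; apply: integral_ge0 => y _; rewrite lee_fin.
- move=> x _ a b ab; apply: ge0_le_integral => //.
  + by move=> y _; rewrite lee_fin.
  + exact/measurable_EFinP.
  + exact/measurable_EFinP.
  + by move=> y _; rewrite lee_fin; exact/lefP/nd_nnsfun_approx.
Qed.

End mixture.

Section weighted_image.
Local Open Scope ereal_scope.
Context d1 d2 (X : measurableType d1) (Y : measurableType d2) (R : realType).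
Variables (mu : {measure set X -> \bar R}) (w : X -> R) (phi : X -> Y).
Hypotheses (w0 : forall x, (0 <= w x)%R) (mw : measurable_fun [set: X] w).
Hypothesis mphi : measurable_fun [set: X] phi.

(** Densities, restrictions and images of measures are all mixtures of scaled Dirac masses, so that
    [integral_mixture] yields their change of variables formulas at once. *)
Definition weighted_dirac of (forall x, (0 <= w x)%R) :=
  fun x : X => mscale (NngNum (w0 x)) \d_(phi x) : {measure set Y -> \bar R}.

Lemma weighted_diracE x B : weighted_dirac w0 x B = (w x * \1_B (phi x))%:E.
Proof. by rewrite /weighted_dirac/= /mscale/= diracE EFinM indicE. Qed.

Lemma measurable_weighted_dirac B : measurable B ->
  measurable_fun [set: X] (fun x => weighted_dirac w0 x B).
Proof.
move=> mB; under eq_fun do rewrite weighted_diracE.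
apply/measurable_EFinP/measurable_funM => //.
exact: (measurableT_comp (measurable_indic mB)).
Qed.

(* The image by [phi] of the measure of density [w] w.r.t. [mu]. *)
Definition weighted_image := mixture mu measurable_weighted_dirac.

HB.instance Definition _ := Measure.on weighted_image.

Lemma weighted_imageE B : weighted_image B = \int[mu]_x (w x * \1_B (phi x))%:E.
Proof. by apply: eq_integral => x _; rewrite weighted_diracE. Qed.

Lemma integral_weighted_image (f : Y -> \bar R) :
  measurable_fun [set: Y] f -> (forall y, 0 <= f y) ->
  \int[weighted_image]_y f y = \int[mu]_x ((w x)%:E * f (phi x)).
Proof.
move=> mf f0; rewrite integral_mixture//; apply: eq_integral => x _.
by rewrite /weighted_dirac ge0_integral_mscale// integral_dirac// diracT mul1e.
Qed.

End weighted_image.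

Section kernel_law.
Context d1 d2 (X : measurableType d1) (Y : measurableType d2) (R : realType).
Variables (P : R.-pker X ~> Y) (x : X).

(** [P x] under a name that carries the structure of a probability, which lemmas on finite measures
    and on products ask for. *)
Definition kernel_law : set Y -> \bar R := P x.

HB.instance Definition _ := Measure.on kernel_law.

HB.instance Definition _ :=
  Measure_isProbability.Build _ _ _ kernel_law (prob_kernel x).

End kernel_law.

(** * Small sets of a kernel composed with itself *)

Section kernel_density.
Local Open Scope ereal_scope.
Context d (T : measurableType d) (R : realType).
Variables (G : set (set T)) (P : probability T R) (k : R.-fker T ~> T).
Hypotheses (Gcount : countable G) (GT : G setT) (GI : setI_closed G).
Hypothesis mG : d.-measurable = <<s G >>.
Hypothesis Pk : {ae P, forall x, P `<< k x}.

(** The image of [k x] under [y -> (x, y)]. Mixing it over [P] gives the joint law on pairs, and one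
    Radon-Nikodym derivative of [P \x P] with respect to that law is measurable in both variables,
    which derivatives chosen separately for each [x] need not be. *)
Let graph (x : T) : {measure set (T * T)%type -> \bar R} :=
  weighted_image (k x) (fun=> @ler01 R) (@measurable_cst _ _ T R setT 1%R) (pair1_measurable x).

Let integral_graph (f : T * T -> \bar R) x :
  measurable_fun setT f -> (forall z, 0 <= f z) ->
  \int[graph x]_z f z = \int[k x]_y f (x, y).
Proof.
move=> mf f0; rewrite integral_weighted_image//.
by apply: eq_integral => y _; rewrite mul1e.
Qed.

Let graphE C x : measurable C -> graph x C = k x (xsection C x).
Proof.
move=> mC; transitivity (\int[graph x]_z (\1_C z)%:E).
  by rewrite integral_indic// setIT.
rewrite integral_graph//; last exact/measurable_EFinP/measurable_indic.
transitivity (\int[k x]_y (\1_(xsection C x) y)%:E).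
  by apply: eq_integral => y _; rewrite !indicE /= mem_xsection.
by rewrite integral_indic ?setIT//; exact: measurable_xsection.
Qed.

Let mgraph C : measurable C -> measurable_fun [set: T] (graph ^~ C).
Proof.
move=> mC; rewrite (_ : graph ^~ C = fun x => \int[k x]_y (\1_C (x, y))%:E).
  apply: (measurable_fun_integral_finite_kernel (fun z => (\1_C z)%:E)) => //.
  exact/measurable_EFinP/measurable_indic.
apply/funext => x; rewrite -(integral_graph (f := fun z => (\1_C z)%:E))//.
  by rewrite integral_indic// setIT.
exact/measurable_EFinP/measurable_indic.
Qed.

Let joint0 : {measure set (T * T)%type -> \bar R} := mixture P mgraph.

Let joint0_finite : fin_num_fun joint0.
Proof.
apply: lty_fin_num_fun => //=; have [r hr] := measure_uub k.
apply: (@le_lt_trans _ _ (\int[P]_x r%:E)).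
  apply: ge0_le_integral => //; first exact: mgraph.
  move=> x _; rewrite graphE// (_ : xsection _ _ = setT); first exact/ltW.
  by apply/seteqP; split => // y _; rewrite /xsection/= inE.
by rewrite integral_cst// [X in _ * X]probability_setT mule1 ltry.
Qed.

Let joint : {finite_measure set (T * T)%type -> \bar R} :=
  HB.pack (mixture P mgraph) (Measure_isFinite.Build _ _ _ joint0 joint0_finite).

Let PP : probability _ R := P \x P.

Let PP_joint : PP `<< joint.
Proof.
apply/null_content_dominatesP => C mC jC0.
have {jC0} : \int[P]_x `|graph x C| = 0.
  by under eq_integral do rewrite gee0_abs//.
move/ae_eq_integral_abs => /(_ measurableT (mgraph mC)) jC0.
rewrite /PP/= /product_measure1 (ge0_ae_eq_integral (g := cst 0))//=.
- by rewrite integral0.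
- exact: measurable_fun_xsection.
move: jC0 Pk; apply: filterS2 => x /(_ Logic.I) + Px _.
rewrite graphE// => kC0.
apply: ((null_content_dominatesP _ (k x)).1 Px) => //.
exact: measurable_xsection.
Qed.

(* A countable pi-system of generators turns the identity that holds for almost
   every [x], for each [B], into one that holds for almost every [x], for all
   [B] at once. *)
Lemma kernel_density : exists g : T * T -> R, [/\ measurable_fun setT g,
  forall z, (0 <= g z)%R & {ae P, forall x, forall B, measurable B ->
    P B = \int[k x]_(y in B) (g (x, y))%:E}].
Proof.
have [f [f0 ffin fint fE]] := radon_nikodym_sigma_finite PP_joint.
have mf := measurable_int _ fint.
pose g z := fine (f z).
have fg z : f z = (g z)%:E by rewrite /g fineK.
have mg : measurable_fun setT g.
  by apply/measurable_EFinP; apply: eq_measurable_fun mf => z _; rewrite /= fg.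
have g0 z : (0 <= g z)%R by exact: fine_ge0.
exists g; split => //.
pose h B x := \int[k x]_(y in B) (g (x, y))%:E.
have hT B x : measurable B -> h B x = \int[k x]_y ((g (x, y))%:E * (\1_B y)%:E).
  by move=> mB; rewrite /h integral_mkcond; apply: eq_integral => y _; rewrite epatch_indic.
have mh B : measurable B -> measurable_fun setT (h B).
  move=> mB; rewrite (funext (fun x => hT B x mB)).
  apply: (measurable_fun_integral_finite_kernel (fun z => (g z)%:E * (\1_B z.2)%:E)).
    by move=> z; rewrite mule_ge0// lee_fin.
  apply: emeasurable_funM; apply/measurable_EFinP => //.
  exact: (measurableT_comp (measurable_indic mB)).
(* The Radon-Nikodym identity on a rectangle. As [A] is arbitrary, [h B] equals the constant [P B]
   almost everywhere. *)
have intAB A B : measurable A -> measurable B ->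
    \int[P]_(x in A) h B x = P A * P B.
  move=> mA mB; rewrite -[RHS]product_measure1E// -[RHS]/(PP _) fE; last exact: measurableX.
  rewrite [RHS]integral_mkcond integral_mixture; last 2 first.
  - apply/(measurable_restrictT _ _).1; first exact: measurableX.
    exact: measurable_funTS.
  - by move=> z; apply: erestrict_ge0.
  rewrite [LHS]integral_mkcond; apply: eq_integral => x _.
  rewrite integral_graph; last 2 first.
  - apply/(measurable_restrictT _ _).1; first exact: measurableX.
    exact: measurable_funTS.
  - by move=> z; apply: erestrict_ge0.
  rewrite [LHS]patchE hT//.
  have [xA|xA] := ifPn; last first.
    rewrite integral0_eq// => y _; rewrite patchE ifF//.
    by apply/negbTE; apply: contra xA; rewrite !inE => -[].
  apply: eq_integral => y _; rewrite patchE fg indicE; move: xA; rewrite inE => xA.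
  rewrite (_ : ((x, y) \in A `*` B) = (y \in B)).
    by case: ifP => _; rewrite ?mule1 ?mule0.
  by apply/idP/idP; rewrite !inE//= => -[].
have hP B : measurable B -> {ae P, forall x, P B = h B x}.
  move=> mB; have : ae_eq P setT (cst (P B)) (h B).
    apply: integral_ae_eq => //; last first.
    - by move=> A _ mA; rewrite intAB// integral_cst// muleC.
    - exact: mh.
    - rewrite (_ : cst _ = EFin \o cst (fine (P B))).
        exact: finite_measure_integrable_cst.
      by apply/funext => x /=; rewrite fineK ?fin_num_measure.
  by apply: filterS => x /(_ Logic.I).
have [S SG] : exists S : (set T)^nat, G = range S.
  have /pfcard_geP[|[S]] := Gcount; first by move=> G0; have := GT; rewrite G0.
  exists S; apply/seteqP; split => [B /(@surj _ _ _ _ S)[n _ <-]|_ [n _ <-]].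
    by exists n.
  exact: funS.
have GS n : G (S n) by rewrite SG; exists n.
have Gm B : G B -> measurable B by rewrite mG; exact: sub_sigma_algebra.
have := ae_foralln (fun n => hP (S n) (Gm _ (GS n))).
apply: filterS => x PhS B mB.
have mgx : measurable_fun [set: T] (fun y => g (x, y)).
  exact: (measurableT_comp mg (pair1_measurable x)).
pose dens := weighted_image (k x) (fun y => g0 (x, y)) mgx (@measurable_id _ T setT).
have densE A : measurable A -> dens A = h A x.
  by move=> mA; rewrite /dens weighted_imageE hT.
rewrite -[RHS]densE//; apply: (measure_unique G (fun=> setT)) => //.
- by apply/seteqP; split => // y _; exists 0%N.
- move=> A GA; transitivity (h A x); last by rewrite -densE//; exact: Gm.
  by move: GA; rewrite SG => -[n _ <-]; exact: PhS.
- by move=> _; rewrite (le_lt_trans (probability_le1 P _)) ?ltry.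
Qed.

End kernel_density.

(** * A lower bound for the kernel composed with itself *)

Section small_set.
Local Open Scope ereal_scope.
Context d (T : measurableType d) (R : realType).

Lemma markov_inequality (P : {measure set T -> \bar R}) (a : T -> \bar R) (r s : R) :
  measurable_fun setT a -> (forall x, 0 <= a x) -> (0 < r)%R ->
  \int[P]_x a x <= (r * s)%:E -> P [set x | r%:E <= a x] <= s%:E.
Proof.
move=> ma a0 r0 ars; rewrite -(@lee_pmul2l _ r%:E) ?lte_fin// -EFinM.
apply: le_trans ars; have := le_integral_abse P measurableT ma r0.
rewrite setTI; under eq_fun do rewrite gee0_abs//.
by under eq_integral do rewrite gee0_abs//.
Qed.

Variables (G : set (set T)) (P : probability T R) (k : R.-fker T ~> T).
Hypotheses (Gcount : countable G) (GT : G setT) (GI : setI_closed G).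
Hypothesis mG : d.-measurable = <<s G >>.
Hypothesis Pk : {ae P, forall x, P `<< k x}.

(* Off a set [bad] of small measure the density of [P] with respect to [k] is at
   most [n.+1]. If the sections of [bad] at [x] and at [z] both have measure at
   most 1/4, then a [P]-half of the intermediate points [y] is good for both, so
   that the kernel composed with itself has density at least [c] at [(x, z)]. *)
Lemma small_set : exists (c : R) (A B0 : set T),
  [/\ (0 < c)%R, measurable A /\ measurable B0, 0 < P A, 0 < P B0 &
      forall x B, A x -> measurable B ->
        c%:E * P (B `&` B0) <= \int[k x]_y k y B].
Proof.
have [g [mg g0 [N [mN PN0 NP]]]] := kernel_density Gcount GT GI mG Pk.
have good x : ~ N x -> forall h : T -> \bar R, measurable_fun setT h ->
    (forall y, 0 <= h y) -> \int[P]_y h y = \int[k x]_y ((g (x, y))%:E * h y).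
  move=> Nx h mh h0.
  have Px B : measurable B -> P B = \int[k x]_(y in B) (g (x, y))%:E.
    by move: B; apply: contrapT => nP; apply: Nx; exact: NP.
  have mgx : measurable_fun [set: T] (fun y => g (x, y)).
    exact: (measurableT_comp mg (pair1_measurable x)).
  rewrite -(integral_weighted_image (k x) (fun y => g0 (x, y)) mgx (@measurable_id _ T setT) mh h0).
  apply: eq_measure_integral => B mB _; rewrite [LHS]Px//.
  apply: etrans (esym (weighted_imageE (k x) (fun y => g0 (x, y)) mgx (@measurable_id _ T setT) B)).
  rewrite integral_mkcond.
  by apply: eq_integral => y _; rewrite epatch_indic.
pose S (n : nat) := [set z | (n.+1%:R < g z)%R].
have mS n : measurable (S n).
  rewrite /S -[X in measurable X]setTI.
  have := measurable_fun_ltr (@measurable_cst _ _ _ _ setT (n.+1%:R : R)) mg.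
  by move=> /(_ measurableT [set true]); apply.
(* The sets [S n] decrease to the empty set. The bound 1/16 is 1/4 times 1/4: by Markov's inequality
   the points whose section has measure at least 1/4 then have measure at most 1/4, in either
   variable. *)
have [n PSn] : exists n, (P \x P) (S n) <= (4^-1 * 4^-1)%:E.
  have : (P \x P) \o S @ \oo --> (P \x P) (\bigcap_n S n).
    apply: nonincreasing_cvg_mu => //.
    - by rewrite (le_lt_trans (probability_le1 (P \x P : probability _ R) _)) ?ltry.
    - exact: bigcapT_measurable.
    - move=> i j ij; apply/subsetPset => z; apply: le_lt_trans.
      by rewrite ler_nat.
  rewrite (_ : \bigcap_n S n = set0) ?measure0; last first.
    apply/seteqP; split => // z /(_ (Num.bound (g z)) Logic.I).
    rewrite /S/= => h; exfalso; move: h; apply/negP; rewrite -leNgt.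
    apply/ltW/(lt_le_trans (archi_boundP (g0 z))).
    by rewrite ler_nat.
  move=> /fine_cvgP[finS /cvgr_le/(_ (4^-1 * 4^-1)%R)] leS.
  near \oo => n; exists n; rewrite -[leLHS]fineK; last by near: n.
  by rewrite lee_fin; near: n; apply: leS; rewrite mulr_gt0.
pose bad := S n.
pose U x := xsection bad x; pose V z := ysection bad z.
have mU x : measurable (U x) by apply: measurable_xsection; exact: mS.
have mV z : measurable (V z) by apply: measurable_ysection; exact: mS.
pose X1 := [set x | (4^-1)%:E <= P (U x)].
pose Z1 := [set z | (4^-1)%:E <= P (V z)].
have mPU : measurable_fun setT (fun x => P (U x)) by apply: measurable_fun_xsection; exact: mS.
have mPV : measurable_fun setT (fun z => P (V z)) by apply: measurable_fun_ysection; exact: mS.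
have PX1 : P X1 <= (4^-1)%:E by apply: markov_inequality => //.
have PZ1 : P Z1 <= (4^-1)%:E.
  apply: markov_inequality => //; rewrite (_ : \int[P]_x _ = (P \x P) bad)//.
  rewrite -[LHS]/((P \x^ P) bad); apply/esym.
  apply: (@product_measure_unique _ _ _ _ _ P P (P \x^ P)) => [A B mA mB|].
    exact: product_measure2E.
  exact: mS.
have mX1 : measurable X1 by rewrite -[X1]setTI; exact: emeasurable_fun_c_infty.
have mZ1 : measurable Z1 by rewrite -[Z1]setTI; exact: emeasurable_fun_c_infty.
pose c : R := (n.+1%:R^-1)%R.
have c0 : (0 < c)%R by rewrite invr_gt0.
(* One factor [c] for each of the two kernels, and 1/2 for the share of the intermediate points that
   are good for both ends. *)
exists (c * c * 2^-1)%R, (~` (X1 `|` N)), (~` Z1); split.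
- by rewrite !mulr_gt0.
- by split; apply: measurableC => //; exact: measurableU.
- rewrite probability_setC; last exact: measurableU.
  rewrite sube_gt0; apply: (le_lt_trans (measureU2 _ mX1 mN)).
  by rewrite [X in _ + X]PN0 adde0 (le_lt_trans PX1)// lte_fin; lra.
- by rewrite probability_setC// sube_gt0 (le_lt_trans PZ1)// lte_fin; lra.
(* Off [U x] the density is at most [n.+1], the inverse of [c], so that there [c] times [P] is below
   [k x]. *)
have key x h : ~ N x -> measurable_fun setT h -> (forall y, 0 <= h y) ->
    c%:E * \int[P]_y ((\1_(~` U x) y)%:E * h y) <= \int[k x]_y h y.
  move=> Nx mh h0.
  have mUh : measurable_fun setT (fun y => (\1_(~` U x) y)%:E * h y).
    apply: emeasurable_funM => //.
    by apply/measurable_EFinP/measurable_indic/measurableC.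
  have Uh0 y : 0 <= (\1_(~` U x) y)%:E * h y by rewrite mule_ge0// lee_fin.
  have mgx : measurable_fun [set: T] (fun y => g (x, y)).
    exact: (measurableT_comp mg (pair1_measurable x)).
  rewrite (good x)// -ge0_integralZl//; last 3 first.
  - by apply: emeasurable_funM => //; exact/measurable_EFinP.
  - by move=> y _; rewrite mule_ge0// lee_fin.
  - by rewrite lee_fin ltW.
  apply: ge0_le_integral => //.
  - by move=> y _; rewrite !mule_ge0// lee_fin// ltW.
  - apply: emeasurable_funM => //; apply: emeasurable_funM => //.
    exact/measurable_EFinP.
  - move=> y _; rewrite indicE.
    have [|_] := boolP (y \in _); last by rewrite mul0e !mule0 h0.
    rewrite inE mul1e muleA => Uxy; rewrite -EFinM -[leRHS]mul1e lee_pmul//.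
      by rewrite lee_fin mulr_ge0// ltW.
    rewrite lee_fin /c mulrC ler_pdivrMr// mul1r leNgt; apply/negP => gxy.
    by apply: Uxy; rewrite /U /xsection/= inE.
move=> x B /not_orP[X1x Nx] mB.
(* In [F (y, z)] the step from [x] to [y] is good, the step from [y] to [z] is good, and [z] lies in
   [B]. *)
pose F (z : T * T) : \bar R := (\1_(~` U x) z.1 * (\1_(~` bad) z * \1_B z.2))%R%:E.
have mF : measurable_fun setT F.
  apply/measurable_EFinP; apply: measurable_funM.
    exact: (measurableT_comp (measurable_indic (measurableC (mU x)))).
  apply: measurable_funM; first exact: (measurable_indic (measurableC (mS n))).
  exact: (measurableT_comp (measurable_indic mB)).
have F0 z : 0 <= F z by rewrite lee_fin !mulr_ge0.
have mB' : measurable_fun setT (fun y => k y B) by exact: measurable_kernel.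
apply: le_trans (key x _ Nx mB' (fun y => measure_ge0 _ _)).
rewrite EFinM EFinM -!muleA lee_pmul2l ?lte_fin//.
(* Here [key] is used at the intermediate point [y], hence only for [y] outside of the null set
   [N]. *)
apply: (@le_trans _ _ (c%:E * \int[P]_y \int[P]_z F (y, z))); last first.
  rewrite -ge0_integralZl//; last 3 first.
  - exact: measurable_fun_fubini_tonelli_F.
  - by move=> y _; exact: integral_ge0.
  - by rewrite lee_fin ltW.
  apply: ae_ge0_le_integral => //.
  - by move=> y _; rewrite mule_ge0 ?integral_ge0// lee_fin ltW.
  - by apply: measurable_funeM; exact: measurable_fun_fubini_tonelli_F.
  - apply: emeasurable_funM => //.
    by apply/measurable_EFinP/measurable_indic/measurableC.
  - exists N; split => // y nle; apply: contrapT => Ny; apply: nle => _.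
    rewrite [in leRHS]indicE; have [|Uxy] := boolP (y \in _); last first.
      rewrite mul0e integral0_eq ?mule0// => z _.
      by rewrite /F/= indicE (negbTE Uxy) mul0r.
    move=> Uxy; rewrite mul1e.
    have : \int[k y]_z (\1_B z)%:E = k y B by rewrite integral_indic ?setIT.
    move=> <-; apply: le_trans (key y _ Ny _ _).
    - rewrite lee_pmul2l ?lte_fin//; apply: ge0_le_integral => //.
      + by apply: measurableT_comp mF _; exact: pair1_measurable.
      + apply: emeasurable_funM; apply/measurable_EFinP/measurable_indic => //.
        exact: measurableC.
      + move=> z _; rewrite -EFinM lee_fin /F/= indicE Uxy mul1r.
        rewrite ler_wpM2r// !indicE ler_nat; case: (boolP (_ \in ~` bad)) => //.
        by rewrite inE => badyz; rewrite mem_set// /U /xsection/= inE.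
    - exact/measurable_EFinP/measurable_indic.
    - by move=> z; rewrite lee_fin.
(* With the order exchanged, [z] outside of [Z1] is fixed and [y] has to avoid [U x] and [V z],
   which together have measure at most 1/2. *)
rewrite lee_pmul2l ?lte_fin// (fubini_tonelli F)//.
have PB : P (B `&` ~` Z1) = \int[P]_z (\1_(B `&` ~` Z1) z)%:E.
  by rewrite integral_indic ?setIT//; apply: measurableI => //; exact: measurableC.
rewrite PB -ge0_integralZl//; last first.
  by apply/measurable_EFinP/measurable_indic/measurableI => //; exact: measurableC.
apply: ge0_le_integral => //.
- apply: measurable_funeM; apply/measurable_EFinP/measurable_indic.
  by apply: measurableI => //; exact: measurableC.
- exact: measurable_fun_fubini_tonelli_G.
- move=> z _; rewrite indicE; have [|_] := boolP (z \in _); last first.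
    by rewrite mule0; exact: integral_ge0.
  rewrite inE mule1 => -[Bz Z1z].
  have -> : \int[P]_y F (y, z) = P (~` (U x `|` V z)).
    transitivity (\int[P]_y (\1_(~` (U x `|` V z)) y)%:E); last first.
      by rewrite integral_indic ?setIT//; apply/measurableC/measurableU.
    apply: eq_integral => y _; rewrite /F/= setCU indicI.
    rewrite (_ : \1_(~` bad) (y, z) = \1_(~` V z) y :> R); last first.
      rewrite !indicE; congr (_ (nat_of_bool _)); apply/idP/idP.
        by rewrite !inE /V /ysection/= inE.
      by rewrite !inE /V /ysection/= inE.
    by rewrite /= (indicE _ B) mem_set// mulr1.
  rewrite probability_setC; last exact: measurableU.
  have Pfin : P (U x `|` V z) \is a fin_num by rewrite fin_num_measure//; exact: measurableU.
  rewrite leeBrDr// -leeBrDl//.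
  apply: (le_trans (measureU2 _ (mU x) (mV z))).
  move/negP : X1x; rewrite -ltNge => /ltW X1x.
  move/negP : Z1z; rewrite -ltNge => /ltW Z1z.
  by apply: (le_trans (leeD X1x Z1z)); rewrite -EFinD -EFinB lee_fin; lra.
Unshelve. all: by end_near. Qed.

End small_set.

(** * The Borel sigma-algebra of R^d *)

Section erosion.
Context {R : realType} {V : normedModType R}.
Implicit Types (U : set V) (x y : V).

(** Closed sets that exhaust an open [U], each in the interior of the next. They turn statements
    about limits in [U] into countable conditions. *)
Definition erosion U (n : nat) : set V := [set x | ball x n.+1%:R^-1 `<=` U].

Lemma erosion_sub U n : erosion U n `<=` U.
Proof. by move=> x; apply; apply: ballxx; rewrite invr_gt0. Qed.

Lemma erosion_le U n p : (n <= p)%N -> erosion U n `<=` erosion U p.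
Proof.
move=> np x Ux y xy; apply: Ux; apply: le_ball xy.
by rewrite lef_pV2 ?posrE// ler_nat ltnS.
Qed.

Lemma bigcup_erosion U : open U -> U = \bigcup_n erosion U n.
Proof.
move=> oU; apply/seteqP; split => [x Ux|x [n _]]; last exact: erosion_sub.
have /nbhs_ballP[e /= e0 eU] := open_nbhs_nbhs (conj oU Ux).
exists (Num.truncn e^-1) => // y xy; apply: eU; apply: le_ball xy.
by rewrite invf_ple ?posrE// ltW// truncnS_gt.
Qed.

Lemma erosion_nbhs U n x : erosion U n x -> nbhs x (erosion U n.+1).
Proof.
move=> Ux; apply/nbhs_ballP; exists (n.+1%:R^-1 - n.+2%:R^-1) => /=.
  by rewrite subr_gt0 ltf_pV2 ?posrE// ltr_nat.
move=> y xy z yz; apply: Ux.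
by rewrite -(subrK n.+2%:R^-1 n.+1%:R^-1); exact: ball_triangle xy yz.
Qed.

Lemma closed_erosion U n : closed (erosion U n).
Proof.
move=> x clx y; rewrite -ball_normE /= => xy.
have e0 : 0 < n.+1%:R^-1 - `|x - y| by rewrite subr_gt0.
have [z [Uz]] := clx _ (nbhsx_ballx x _ e0).
rewrite -ball_normE /= => xz; apply: Uz; rewrite -ball_normE /=.
rewrite -(subrK x z) -addrA (le_lt_trans (ler_normD _ _))// distrC.
by rewrite -ltrBrDr.
Qed.

Lemma erosion_eventually U (f : nat -> V) (x : V) : open U ->
  f n @[n --> \oo] --> x ->
  U x <-> exists n, \forall p \near \oo, erosion U n (f p).
Proof.
move=> oU fx; split => [|[n nU]].
  rewrite {1}(bigcup_erosion oU) => -[n _ /erosion_nbhs nU].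
  by exists n.+1; exact: fx.
apply: erosion_sub; exact: (closed_cvg _ (@closed_erosion U n) nU _ fx).
Qed.

End erosion.

Section borel_rV.
Context {R : realType} {d : nat}.
Local Notation E := 'rV[R]_d.

Lemma open_measurable_rV (U : set E) : open U -> measurable U.
Proof. exact: sub_sigma_algebra. Qed.

Lemma closed_measurable_rV (U : set E) : closed U -> measurable U.
Proof.
move=> cU; rewrite -(setCK U); apply: measurableC; apply: open_measurable_rV.
exact: closed_openC.
Qed.

Lemma measurable_fun_rV d' (T : measurableType d') (f : T -> E) :
  (forall U : set E, open U -> measurable (f @^-1` U)) -> measurable_fun setT f.
Proof.
move=> mf; apply: (@measurability _ _ _ _ setT f (@open E)) => //.
by move=> _ [U oU <-]; rewrite setTI; exact: mf.
Qed.

Lemma continuous_measurable_rV (f : E -> R) : continuous f -> measurable_fun setT f.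
Proof.
move=> /continuousP cf; apply: (measurability _ (RGenOInfty.measurableE R)).
move=> _ [_ [x ->] <-]; rewrite setTI; apply: open_measurable_rV.
by apply: cf; exact: interval_open.
Qed.

Definition rational_ball (c : 'rV[rat]_d * nat) : set E :=
  ball (map_mx (ratr : rat -> R) c.1 : E) c.2.+1%:R^-1.

(** Finite intersections make the family a pi-system, and the empty list provides [setT], as
    [small_set] requires. *)
Definition rational_balls : set (set E) :=
  range (fun s : seq ('rV[rat]_d * nat) => \bigcap_(c in [set` s]) rational_ball c).

Lemma countable_rational_balls : countable rational_balls.
Proof. exact/(card_le_trans (card_image_le _ _))/countableP. Qed.

Lemma setT_rational_balls : rational_balls setT.
Proof. by exists [::] => //; apply/seteqP; split => // x _ c. Qed.

Lemma setI_rational_balls : setI_closed rational_balls.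
Proof.
move=> _ _ [s _ <-] [t _ <-]; exists (s ++ t) => //.
apply/seteqP; split => [x stx|x [sx tx] c /=].
  by split => c /= cst; apply: stx; rewrite /= mem_cat cst ?orbT.
by rewrite mem_cat => /orP[/sx|/tx].
Qed.

Lemma rational_ball_dense (U : set E) (x : E) : open U -> U x ->
  exists c, rational_ball c x /\ rational_ball c `<=` U.
Proof.
move=> oU Ux; have /nbhs_ballP[e /= e0 eU] := open_nbhs_nbhs (conj oU Ux).
(* Twice the radius [r] is at most [e]. The norm is the sup norm, so the centre is approximated
   coordinate by coordinate. *)
pose n := Num.truncn (2 / e); pose r : R := n.+1%:R^-1.
have r0 : 0 < r by rewrite invr_gt0.
have re : r + r <= e.
  rewrite -mulr2n -mulr_natl -ler_pdivlMl// /r invf_ple ?posrE// ?mulr_gt0 ?invr_gt0//.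
  by rewrite invfM invrK ltW// truncnS_gt.
have [q qx] : exists q : 'rV[rat]_d, forall i j, ball (ratr (q i j) : R) r (x i j).
  have qP i j : exists q : rat, ball (ratr q : R) r (x i j).
    have xr : x i j - r < x i j + r by rewrite ltrD2l gtrN.
    have [q] := rat_in_itvoo xr; rewrite in_itv/= => /andP[xq qx].
    by exists q; rewrite -ball_normE /= ltr_norml; apply/andP; split; lra.
  exists (\matrix_(i, j) sval (cid (qP i j))) => i j; rewrite mxE.
  exact: svalP (cid (qP i j)).
have qrx : rational_ball (q, n) x by split => // i j; rewrite mxE; exact: qx.
exists (q, n); split => // y qy; apply: eU; apply: (le_ball re).
exact: ball_triangle (ball_sym qrx) qy.
Qed.

Lemma rational_ballsE : @measurable _ E = <<s rational_balls >>.
Proof.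
apply/seteqP; split.
  apply: smallest_sub; first exact: smallest_sigma_algebra.
  move=> U oU.
  rewrite (_ : U = \bigcup_(c in [set c | rational_ball c `<=` U]) rational_ball c).
    rewrite bigcup_mkcond.
    apply: (@countable_bigcupT_measurable _ (g_sigma_algebraType rational_balls)).
      exact: countableP.
    move=> c; case: ifP => _; last exact: measurable0.
    apply: sub_sigma_algebra; exists [:: c] => //.
    by rewrite set_cons1 bigcap_set1.
  apply/seteqP; split => [x Ux|x [c cU]]; last exact: cU.
  by have [c [cx cU]] := rational_ball_dense oU Ux; exists c.
apply: smallest_sub; first exact: sigma_algebra_measurable.
move=> _ [s _ <-]; rewrite bigcap_seq; apply: bigsetI_measurable => c _.
apply: open_measurable_rV; exact: ball_open.
Qed.

End borel_rV.

(** * A test function for the martingale problem *)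

Lemma bounded_fun_le {R : realType} (T : Type) (f : T -> R) (M : R) :
  (forall t, `|f t| <= M) -> bounded_fun f.
Proof.
move=> fM; exists M; split => [|r Mr t _]; first exact: num_real.
exact: le_trans (fM t) (ltW Mr).
Qed.

Lemma bounded_funP {R : realType} (T : Type) (f : T -> R) :
  bounded_fun f -> exists2 M : R, 0 <= M & forall t, `|f t| <= M.
Proof.
move=> [M [_ fM]]; exists (Num.max 0 (M + 1)); first by rewrite le_max lexx.
by move=> t; apply: (fM _ _ t) => //; rewrite lt_max ltrDl ltr01 orbT.
Qed.

(** One coordinate of the compensated jump of [bump]: for q(t) = 1 / (1 + t^2) the factor
    [2 * u * (1 + u ^+ 2)^-1 ^+ 2] is -q'(u), and [s] stands for the squared length of the whole
    jump. Large jumps need only boundedness; for small ones the remainder is of second order. *)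
Lemma taylor_remainder {R : realFieldType} (u v s : R) : v ^+ 2 <= s ->
  `|(1 + u ^+ 2)^-1 - (1 + (u + v) ^+ 2)^-1 -
    v * (2 * u * (1 + u ^+ 2)^-1 ^+ 2) / (1 + s)| <= 3 * Num.min 1 s.
Proof.
move=> vs.
have s0 : 0 <= s by apply: le_trans vs; rewrite sqr_ge0.
have u0 : 0 < 1 + u ^+ 2 by rewrite ltr_pwDl// sqr_ge0.
have w0 : 0 < 1 + (u + v) ^+ 2 by rewrite ltr_pwDl// sqr_ge0.
have s1 : 0 < 1 + s by rewrite ltr_pwDl.
set a := (1 + u ^+ 2)^-1; set b := (1 + (u + v) ^+ 2)^-1.
have a0 : 0 < a by rewrite invr_gt0.
have b0 : 0 < b by rewrite invr_gt0.
have a1 : a <= 1 by rewrite invf_le1// lerDl sqr_ge0.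
have b1 : b <= 1 by rewrite invf_le1// lerDl sqr_ge0.
have aK : a * (1 + u ^+ 2) = 1 by rewrite mulVf// gt_eqF.
have bK : b * (1 + (u + v) ^+ 2) = 1 by rewrite mulVf// gt_eqF.
(* The two squares give [2 * |t| <= 1 + t ^+ 2], and the right-hand side is the inverse of [r]. *)
have norm_half (t r : R) : 0 < r -> r <= 1 -> r * (1 + t ^+ 2) = 1 ->
    `|2 * t * r| <= 1.
  move=> r0 r1 rt; have := sqr_ge0 (1 + t); have := sqr_ge0 (1 - t) => h1 h2.
  have := mulr_ge0 (ltW r0) h1; have := mulr_ge0 (ltW r0) h2.
  by rewrite ler_norml => ? ?; apply/andP; split; nra.
have gu : `|2 * u * a| <= 1 by exact: norm_half.
have gw : `|2 * (u + v) * b| <= 1 by exact: norm_half.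
have gua : `|2 * u * a ^+ 2| <= 1.
  by rewrite expr2 mulrA normrM (gtr0_norm a0) -[leRHS]mulr1 ler_pM// ltW.
have -> : v * (2 * u * a ^+ 2) / (1 + s) = (2 * u * a ^+ 2) * (v / (1 + s)) by ring.
have [s1'|s1'] := leP 1 s.
  have ab1 : `|a - b| <= 1 by rewrite ler_norml; lra.
  rewrite mulr1 (le_trans (ler_normB _ _))// (_ : 3 = 1 + 2); last by ring.
  rewrite lerD// normrM (@le_trans _ _ (1 * 1))//; last by rewrite mulr1 ler1n.
  rewrite ler_pM// normrM normfV (gtr0_norm s1) ler_pdivrMr// mul1r.
  rewrite (le_trans _ (_ : 1 + v ^+ 2 <= 1 + s))// ?lerD2l//.
  rewrite -(real_normK (num_real v)); have := sqr_ge0 (`|v| - 1).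
  by have := normr_ge0 v; nra.
have v1 : `|v| <= 1 by rewrite -(@ler_sqr _ `|v| 1) ?nnegrE// real_normK ?num_real// expr1n; lra.
(* The first summand is the exact Taylor remainder, at most [2 * s]; the second is the error of
   dividing [v] by [1 + s], at most [s]. *)
have -> : a - b - 2 * u * a ^+ 2 * (v / (1 + s)) =
    v ^+ 2 * ((1 - u ^+ 2) * a * a * b - 2 * u * a ^+ 2 * ((u + v) * b)) +
    2 * u * a ^+ 2 * v * (s / (1 + s)).
  by rewrite /a /b; field; rewrite !gt_eqF.
rewrite (le_trans (ler_normD _ _))// (_ : 3 * s = 2 * s + s); last by ring.
rewrite lerD//.
  rewrite normrM mulrC ler_pM// ?normrX ?real_normK ?num_real//.
  rewrite (le_trans (ler_normB _ _))// (_ : 2 = 1 + 1); last by ring.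
  rewrite lerD//.
    have h1 : `|(1 - u ^+ 2) * a| <= 1.
      by rewrite ler_norml; apply/andP; split; nra.
    rewrite normrM (gtr0_norm b0) -[leRHS]mulr1 ler_pM// ?(ltW b0)//.
    by rewrite normrM (gtr0_norm a0) -[leRHS]mulr1 ler_pM// ltW.
  rewrite normrM -[leRHS]mulr1 ler_pM//.
  by move: gw; rewrite -mulrA normrM ger0_norm//; have := normr_ge0 ((u + v) * b); lra.
rewrite normrM normrM (ger0_norm (_ : 0 <= s / (1 + s))) ?divr_ge0 ?(ltW s1)//.
rewrite -[leRHS]mul1r ler_pM// ?divr_ge0 ?(ltW s1)//.
  by rewrite -[leRHS]mulr1 ler_pM.
by rewrite ler_pdivrMr//; nra.
Qed.

Section bump.
Context {R : realType} {d : nat}.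
Local Notation E := 'rV[R]_d.
Variable y : E.
Implicit Types (i j : 'I_d) (x v : E).

Let u i x : R := x 0 i - y 0 i.
Let q i x : R := (1 + u i x ^+ 2)^-1.

(* [|x - y|^2] cut off coordinatewise, with a separable, rational formula. *)
Definition bump x : R := \sum_(i < d) (1 - q i x).

Let den_gt0 i x : 0 < 1 + u i x ^+ 2.
Proof. by rewrite ltr_pwDl// sqr_ge0. Qed.

Let q_gt0 i x : 0 < q i x. Proof. by rewrite invr_gt0. Qed.

Let q_le1 i x : q i x <= 1.
Proof. by rewrite invf_le1// lerDl sqr_ge0. Qed.

Let is_derive_u i x v : is_derive x v (u i) (v 0 i).
Proof.
have h : (h^-1 *: ((u i \o shift x) (h *: v) - u i x) : R) @[h --> 0^'] --> v 0 i.
  apply: cvg_near_cst; near=> h.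
  have h0 : h != 0 by near: h; exact: nbhs_dnbhs_neq.
  rewrite /u/= !mxE (_ : _ - _ = h * v 0 i); last by ring.
  by rewrite -[LHS]/(_ * _) mulKf.
by apply: DeriveDef; [exact: (cvgP _ h)|exact: cvg_lim h].
Unshelve. all: by end_near. Qed.

Let is_derive_q i x v : is_derive x v (q i) (- (2 * u i x * q i x ^+ 2) * v 0 i).
Proof.
have hu := is_derive_u i x v.
have hd : is_derive x v (fun z => 1 + u i z ^+ 2) (2 * u i x * v 0 i).
  by apply: is_derive_eq; rewrite add0r -[_ *: _]/(_ * _); ring.
apply: DeriveDef; first by apply: derivableV; [exact: lt0r_neq0|].
rewrite deriveV; [|exact: lt0r_neq0|by []].
rewrite derive_val -[_ *: _]/(_ * _) /q exprVn.
by rewrite -exprVn; ring.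
Qed.

Let dq i x : R := 2 * u i x * q i x ^+ 2.
Let ddq i x : R := 2 * q i x ^+ 2 - 8 * u i x ^+ 2 * q i x ^+ 3.

Let is_derive_bump x v : is_derive x v bump (\sum_(i < d) dq i x * v 0 i).
Proof.
have -> : bump = \sum_(i < d) (fun x => 1 - q i x).
  by apply/funext => z; rewrite fct_sumE.
apply: is_derive_sum => i; have hq := is_derive_q i x v.
by apply: is_derive_eq; rewrite /dq; ring.
Qed.

Let is_derive_dq i x v : is_derive x v (dq i) (ddq i x * v 0 i).
Proof.
have hq := is_derive_q i x v; have hu := is_derive_u i x v.
apply: is_derive_eq; rewrite /ddq /dq.
by rewrite -![_ *: _]/(_ * _); ring.
Qed.

Let partial_bump i : partial_derivative i bump = dq i.
Proof.
apply/funext => x; have h := is_derive_bump x (delta_mx 0 i).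
rewrite /partial_derivative derive_val (bigD1 i)//= mxE !eqxx mulr1 big1 ?addr0// => j ji.
by rewrite mxE (negbTE ji) andbF mulr0.
Qed.

Let partial_dq i j : partial_derivative i (dq j) = if i == j then ddq j else cst 0.
Proof.
apply/funext => x; have h := is_derive_dq j x (delta_mx 0 i).
rewrite /partial_derivative derive_val mxE eqxx eq_sym/=.
by case: ifP => _; rewrite ?mulr1 ?mulr0.
Qed.

Let norm_uq i x : `|u i x * q i x| <= 1.
Proof.
rewrite normrM (gtr0_norm (q_gt0 i x)) ler_pdivrMr// mul1r -real_normK ?num_real//.
by have := sqr_ge0 (`|u i x| - 1); nra.
Qed.

Let norm_q i x : `|q i x| <= 1.
Proof. by rewrite gtr0_norm. Qed.

Let norm_dq i x : `|dq i x| <= 2.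
Proof.
rewrite /dq (_ : _ * _ = 2 * (u i x * q i x) * q i x); last by ring.
by rewrite !normrM ger0_norm// -[leRHS]mulr1 ler_pM// -[leRHS]mulr1 ler_pM// -normrM.
Qed.

Let norm_ddq i x : `|ddq i x| <= 10.
Proof.
have -> : ddq i x = 2 * q i x ^+ 2 - 8 * (u i x * q i x) ^+ 2 * q i x.
  by rewrite /ddq; ring.
rewrite (_ : 10 = 2 + 8); last by ring.
rewrite (le_trans (ler_normB _ _))// lerD//.
  by rewrite normrM normrX ger0_norm// -[leRHS]mulr1 ler_pM// exprn_ile1.
have := norm_uq i x; set a := u i x * q i x => a1.
rewrite normrM normrM normrX (ger0_norm (_ : 0 <= 8))// -[leRHS]mulr1 ler_pM//.
by rewrite -[leRHS]mulr1 ler_pM// exprn_ile1.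
Qed.

Let norm_bump x : `|bump x| <= d%:R.
Proof.
rewrite (le_trans (ler_norm_sum _ _ _))// -[d in leRHS]card_ord -sumr_const.
by apply: ler_sum => i _; rewrite ger0_norm ?subr_ge0// lerBlDr lerDl ltW.
Qed.

Let continuous_u i : continuous (u i).
Proof.
move=> x; apply: (@continuousB _ _ _ (fun x : E => x 0 i) (cst (y 0 i))).
  exact: coord_continuous.
exact: cst_continuous.
Qed.

Let continuous_q i : continuous (q i).
Proof.
move=> x; apply: (@continuousV _ _ (fun z => 1 + u i z ^+ 2)).
  exact: lt0r_neq0.
apply: (@continuousD _ _ _ (cst (1 : R)) (fun z => u i z * u i z)).
  exact: cst_continuous.
by apply: continuousM; exact: continuous_u.
Qed.

Let continuous_dq i : continuous (dq i).
Proof.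
move=> x; apply: (@continuousM _ _ (fun z => 2 * u i z) (fun z => q i z * q i z)).
  by apply: (@continuousM _ _ (cst 2) (u i)); [exact: cst_continuous|exact: continuous_u].
by apply: continuousM; exact: continuous_q.
Qed.

Let continuous_ddq i : continuous (ddq i).
Proof.
have -> : ddq i = fun z => 2 * (q i z * q i z) - 4 * (dq i z * (u i z * q i z)).
  by apply/funext => z; rewrite /ddq /dq; ring.
move=> x; apply: (@continuousB _ _ _ (fun z => 2 * (q i z * q i z))
    (fun z => 4 * (dq i z * (u i z * q i z)))).
  apply: (@continuousM _ _ (cst 2) (fun z => q i z * q i z)).
    exact: cst_continuous.
  by apply: continuousM; exact: continuous_q.
apply: (@continuousM _ _ (cst 4) (fun z => dq i z * (u i z * q i z))).
  exact: cst_continuous.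
apply: (@continuousM _ _ (dq i) (fun z => u i z * q i z)).
  exact: continuous_dq.
by apply: continuousM; [exact: continuous_u|exact: continuous_q].
Qed.

Let continuous_bump : continuous bump.
Proof.
rewrite (_ : bump = \sum_(i < d) (fun x => 1 - q i x)).
  elim/big_ind : _ => [|f g cf cg x|i _ x]; first exact: cst_continuous.
    by apply: continuousD; [exact: cf|exact: cg].
  by apply: (@continuousB _ _ _ (cst (1 : R)) (q i)); [exact: cst_continuous|exact: continuous_q].
by apply/funext => z; rewrite fct_sumE.
Qed.

Lemma C2b_bump : C2b bump.
Proof.
have C0dq i : C0b (partial_derivative i bump).
  by rewrite partial_bump; split => //; exact: (bounded_fun_le (norm_dq i)).
split; split => //.
- by split => //; exact: (bounded_fun_le norm_bump).
- by move=> i x; have h := is_derive_bump x (delta_mx 0 i); exact: ex_derive.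
- move=> j x; rewrite partial_bump.
  by have h := is_derive_dq i x (delta_mx 0 j); exact: ex_derive.
- move=> j; rewrite partial_bump partial_dq; case: ifP => _.
    by split => //; exact: (bounded_fun_le (norm_ddq i)).
  split; first exact: cst_continuous.
  by apply: (@bounded_fun_le _ _ 0) => x; rewrite normr0.
Qed.

Lemma norm_gradient_bump x i : `|gradient bump x 0 i| <= 2.
Proof. by rewrite mxE partial_bump. Qed.

Lemma norm_hessian_bump x i j : `|hessian bump x i j| <= 10.
Proof.
rewrite mxE partial_bump partial_dq; case: ifP => _ //.
by rewrite normr0.
Qed.

Lemma bump_center : bump y = 0.
Proof. by rewrite /bump big1// => i _; rewrite /q /u subrr expr0n addr0 invr1 subrr. Qed.

Lemma bump_ge0 x : 0 <= bump x.
Proof. by apply: sumr_ge0 => i _; rewrite subr_ge0. Qed.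

(** A coordinate that realizes the sup norm already contributes this much, since t / (1 + t)
    increases in t = [u i x ^+ 2]. *)
Lemma bump_far (e : R) x : 0 < e -> e < `|x - y| -> e ^+ 2 / (1 + e ^+ 2) <= bump x.
Proof.
move=> e0 exy; have xy0 : mx_norm (x - y) != 0 by rewrite gt_eqF// (lt_trans e0).
have [[k i] xyi] := mx_norm_neq0 xy0.
have {}xyi : `|x - y| = `|u i x|.
  by rewrite [LHS]xyi /= (ord1 k) !mxE.
apply: (@le_trans _ _ (1 - q i x)); last first.
  by rewrite /bump (bigD1 i)//= lerDl sumr_ge0// => j _; rewrite subr_ge0.
have eu : e ^+ 2 <= u i x ^+ 2.
  by rewrite -(real_normK (num_real (u i x))) ler_sqr ?nnegrE// ?(ltW e0)// -xyi ltW.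
have e1 : 0 < 1 + e ^+ 2 by rewrite ltr_pwDl// sqr_ge0.
rewrite (_ : _ / _ = 1 - (1 + e ^+ 2)^-1); last by field; exact: lt0r_neq0.
by rewrite lerD2l lerN2 lef_pV2 ?posrE// lerD2l.
Qed.

(** [bump] is a sum over coordinates, and [sqnorm z] dominates every [z 0 i ^+ 2], so
    [taylor_remainder] applies to each summand. *)
Lemma bump_taylor x z :
  `|bump (x + z) - bump x - dotp z (gradient bump x) / (1 + sqnorm z)| <=
  d%:R * (3 * Num.min 1 (sqnorm z)).
Proof.
have -> : bump (x + z) - bump x - dotp z (gradient bump x) / (1 + sqnorm z) =
    \sum_(i < d) (q i x - q i (x + z) - z 0 i * dq i x / (1 + sqnorm z)).
  rewrite /bump -sumrB /dotp mulr_suml -sumrB; apply: eq_bigr => i _.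
  by rewrite mxE partial_bump; ring.
rewrite (le_trans (ler_norm_sum _ _ _))// mulr_natl -[X in _ *+ X]card_ord -sumr_const.
apply: ler_sum => i _.
have zi : z 0 i ^+ 2 <= sqnorm z.
  rewrite /sqnorm /dotp (bigD1 i)//= -expr2 lerDl sumr_ge0// => j _.
  by rewrite -expr2 sqr_ge0.
have uz : u i (x + z) = u i x + z 0 i by rewrite /u mxE; ring.
rewrite /dq /q uz; exact: taylor_remainder.
Qed.

End bump.

(** * Path space *)

Section path_space.
Context {R : realType} {d : nat}.
Local Notation E := 'rV[R]_d.
Local Notation Omega := (cadlag_path R d).
Implicit Types (w : Omega) (B : set E) (s t : R).

Lemma path_right w t : w s @[s --> t^'+] --> w t.
Proof. by have [wr _ _] := path_cadlag w; exact: wr. Qed.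

Lemma path_left w t : cvg (w s @[s --> t^'-]).
Proof. by have [_ wl _] := path_cadlag w; exact: wl. Qed.

Lemma path_negative w t : t <= 0 -> w t = w 0.
Proof.
by rewrite le_eqVlt => /predU1P[->//|]; have [_ _] := path_cadlag w; apply.
Qed.

Lemma natural_filtration_cylinder t s B : 0 <= s -> s <= t -> measurable B ->
  natural_filtration t [set w : Omega | B (w s)].
Proof.
move=> s0 st mB; apply: sub_sigma_algebra; exists s; last by exists B.
by rewrite /= in_itv/= s0 st.
Qed.

Lemma natural_filtration_le t u : t <= u ->
  natural_filtration t `<=` @natural_filtration R d u.
Proof.
move=> tu; apply: smallest_sub; first exact: smallest_sigma_algebra.
move=> _ [s + [B mB <-]]; rewrite /= in_itv/= => /andP[s0 st].
by apply: natural_filtration_cylinder => //; exact: le_trans tu.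
Qed.

Lemma natural_filtration_measurable t :
  natural_filtration t `<=` @measurable _ Omega.
Proof.
apply: smallest_sub; first exact: smallest_sigma_algebra.
move=> _ [s + [B mB <-]]; rewrite /= in_itv/= => /andP[s0 st].
apply: sub_sigma_algebra; exists s; last by exists B.
by rewrite /= in_itv/= s0.
Qed.

Lemma measurable_coordinate t : measurable_fun setT (fun w : Omega => w t).
Proof.
move=> _ B mB; rewrite setTI.
have h s : 0 <= s -> measurable [set w : Omega | B (w s)].
  by move=> s0; apply: (@natural_filtration_measurable s); exact: natural_filtration_cylinder.
have [t0|t0] := leP 0 t; first exact: h.
rewrite (_ : _ @^-1` _ = [set w : Omega | B (w 0)]); first exact: h.
by apply/seteqP; split => w; rewrite /= (path_negative w (ltW t0)).
Qed.

(** Retyping the path space with the sigma-algebra of time [t] lets the general measurability lemmas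
    prove adaptedness. *)
Lemma adapted_coordinate t s : 0 <= s -> s <= t ->
  measurable_fun setT
    (fun w : g_sigma_algebraType (@cylinders R d `[0, t]) => (w : Omega) s).
Proof. by move=> s0 st _ B mB; rewrite setTI; exact: natural_filtration_cylinder. Qed.

Lemma measurable_shift_path t : 0 <= t ->
  measurable_fun setT (@shift_path R d t).
Proof.
move=> t0; apply: (@measurability _ _ _ _ setT _ (cylinders `[0, +oo[)) => //.
move=> _ [_ [s + [B mB <-]] <-]; rewrite /= in_itv/= => /andP[s0 _].
by rewrite setTI; have := measurable_coordinate (t + Num.max 0 s) measurableT mB; rewrite setTI.
Qed.

Lemma shift_pathE t s w : 0 <= s -> shift_path t w s = w (t + s).
Proof. by move=> s0; rewrite /= /shift_fun; congr (w (_ + _)); exact/max_idPr. Qed.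

Lemma cvg_at_right_seq (s : nat -> R) (c t : R) : 0 < c ->
  (forall p, t < s p <= t + c / p.+1%:R) -> s p @[p --> \oo] --> t^'+.
Proof.
move=> c0 st A [e /= e0 eA]; change (\forall p \near \oo, A (s p)).
near=> p; have /andP[ts st'] := st p.
apply: eA => //=; rewrite ltr0_norm ?subr_lt0// opprB ltrBlDl.
apply: (le_lt_trans st'); rewrite ltrD2l -ltr_pdivlMl// mulrC.
by near: p; exact: near_infty_natSinv_lt (PosNum (divr_gt0 e0 c0)).
Unshelve. all: by end_near. Qed.

(** The first multiple of [p.+1^-1] strictly after [t]: strictness matters because the filter of
    right continuity excludes [t] itself. *)
Definition grid (p : nat) t : R := (Num.floor (t * p.+1%:R) + 1)%:~R / p.+1%:R.

Lemma grid_itv p t : t < grid p t <= t + p.+1%:R^-1.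
Proof.
have p0 : 0 < p.+1%:R :> R by [].
rewrite /grid ltr_pdivlMr// ler_pdivrMr// mulrDl mulVf ?gt_eqF//.
by rewrite lt_succ_floor//= intrD lerD2r ge_floor.
Qed.

Lemma cvg_path_grid w t : w (grid p t) @[p --> \oo] --> w t.
Proof.
apply: (@cvg_comp _ _ _ (fun p => grid p t) w _ t^'+ _ _ (@path_right w t)).
by apply: (@cvg_at_right_seq _ 1) => // p; rewrite mul1r; exact: grid_itv.
Qed.

Lemma measurable_path_grid p :
  measurable_fun setT (fun z : Omega * R => z.1 (grid p z.2)).
Proof.
move=> _ B mB; rewrite setTI.
pose I (k : int) := [set t : R | (Num.floor (t * p.+1%:R) == k)].
rewrite (_ : _ @^-1` _ = \bigcup_(k : int)
  ([set w : Omega | B (w ((k + 1)%:~R / p.+1%:R))] `*` I k)).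
  apply: countable_bigcupT_measurable => // k; apply: measurableX.
    by have := measurable_coordinate ((k + 1)%:~R / p.+1%:R) measurableT mB; rewrite setTI.
  have p0 : 0 < p.+1%:R :> R by [].
  rewrite (_ : I k = `[k%:~R / p.+1%:R, (k + 1)%:~R / p.+1%:R[%classic)//.
  apply/seteqP; split => t; rewrite /I/= in_itv/= ler_pdivrMr// ltr_pdivlMr//.
    by move=> /eqP <-; exact: floor_itv.
  by move=> ?; apply/eqP; exact: floor_def.
apply/seteqP; split => [[w t] Bwt|[w t] [k _ [/= Bwk /eqP Itk]]].
  by exists (Num.floor (t * p.+1%:R)) => //; split; [exact: Bwt|rewrite /I/=].
by rewrite /grid /= Itk.
Qed.

(** By right continuity evaluation is the limit of evaluations at grid times, which are measurable
    since [grid p] takes countably many values; [erosion_eventually] passes to the limit. *)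
Lemma measurable_path_eval : measurable_fun setT (fun z : Omega * R => z.1 z.2).
Proof.
apply: measurable_fun_rV => U oU.
rewrite (_ : _ @^-1` _ = \bigcup_n \bigcup_k \bigcap_(p in [set p | (k <= p)%N])
    ((fun z : Omega * R => z.1 (grid p z.2)) @^-1` erosion U n)).
  apply: bigcupT_measurable => n; apply: bigcupT_measurable => k.
  apply: bigcap_measurable; first by exists k => /=.
  move=> p _; have mU : measurable (erosion U n).
    by apply: closed_measurable_rV; exact: closed_erosion.
  by have := measurable_path_grid p measurableT mU; rewrite setTI.
apply/seteqP; split => [[w t] /= Uwt|[w t] [n _ [k _ kU]] /=].
  have [n [k _ kU]] := (erosion_eventually oU (@cvg_path_grid w t)).1 Uwt.
  by exists n => //; exists k => // p /= kp; exact: kU.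
apply/(erosion_eventually oU (@cvg_path_grid w t)); exists n.
by exists k => // p kp; exact: kU.
Qed.

End path_space.

Section measurable_distance.
Context {R : realType} {d : nat} d' (T : measurableType d').
Local Notation E := 'rV[R]_d.

Lemma gt_norm_rV (e : R) (x : E) : 0 <= e ->
  (e < `|x|) <-> exists i, e < `|x 0 i|.
Proof.
move=> e0; split => [ex|[i /lt_le_trans]]; last first.
  apply; rewrite [leRHS]mx_normrE.
  exact: (le_bigmax _ (fun ij : 'I_1 * 'I_d => `|x ij.1 ij.2|) (0, i)).
have x0 : mx_norm x != 0 by rewrite gt_eqF// (le_lt_trans e0).
have [[k i] xi] := mx_norm_neq0 x0; exists i.
by move: ex; rewrite [X in _ < X -> _]xi /= (ord1 k).
Qed.

Lemma measurable_coord_rV (f : T -> E) i :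
  measurable_fun setT f -> measurable_fun setT (fun t => f t 0 i).
Proof.
by apply: (measurableT_comp (continuous_measurable_rV (@coord_continuous _ _ _ 0 i))).
Qed.

Lemma measurable_far (e : R) (f g : T -> E) : 0 <= e ->
  measurable_fun setT f -> measurable_fun setT g ->
  measurable [set t | e < `|f t - g t|].
Proof.
move=> e0 mf mg.
rewrite (_ : mkset _ = \bigcup_(i : 'I_d) [set t | e < `|f t 0 i - g t 0 i|]).
  apply: countable_bigcupT_measurable => // i.
  rewrite -[X in measurable X]setTI.
  have mfg : measurable_fun setT (fun t => `|f t 0 i - g t 0 i|).
    apply: measurableT_comp => //.
    by apply: measurable_funB; exact: measurable_coord_rV.
  have := measurable_fun_ltr (@measurable_cst _ _ _ _ setT e) mfg.
  by move=> /(_ measurableT [set true]); apply.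
apply/seteqP; split => [t /(gt_norm_rV _ e0)[i]|t [i _ eti]].
  by rewrite !mxE => ?; exists i.
by apply/(gt_norm_rV _ e0); exists i; rewrite !mxE.
Qed.

End measurable_distance.

(** * Displacement and oscillation of the paths *)

Section inner_integral.
Local Open Scope ereal_scope.
Context d (T : measurableType d) (R : realType) (mu : {measure set T -> \bar R}).

(* The library integral of a nonnegative function is a supremum over simple
   minorants, hence monotone without any measurability assumption. *)
Lemma le_inner_integral (D : set T) (f g : T -> \bar R) :
  (forall x, D x -> 0 <= f x) -> (forall x, D x -> f x <= g x) ->
  \int[mu]_(x in D) f x <= \int[mu]_(x in D) g x.
Proof.
move=> f0 fg; have g0 x : D x -> 0 <= g x by move=> Dx; exact: le_trans (f0 x Dx) (fg x Dx).
rewrite integral_mkcond [leRHS]integral_mkcond.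
rewrite !ge0_integralTE; [|exact: erestrict_ge0..].
apply: ge_ereal_sup => _ [h /= hf <-]; apply: ereal_sup_ubound; exists h => //= x.
by apply: le_trans (hf x) _; apply: lee_restrict.
Qed.

(** The positive and the negative part both have integral in [[0, K]]. No measurability of [f]
    enters, so the bound applies directly to the operator evaluated along a path. *)
Lemma norm_Rintegral_le (D : set T) (f : T -> R) (h : T -> \bar R) (K : R) :
  (forall x, D x -> `|f x|%:E <= h x) -> \int[mu]_(x in D) h x <= K%:E ->
  (`|Rintegral mu D f| <= K)%R.
Proof.
move=> fh hK; rewrite /Rintegral integralE.
have pos : 0 <= \int[mu]_(x in D) (EFin \o f)^\+ x <= K%:E.
  rewrite integral_ge0//=; apply: le_trans hK; apply: le_inner_integral => // x Dx.
  apply: le_trans (fh x Dx); rewrite funeposE /= -EFin_max lee_fin.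
  by rewrite ge_max normr_ge0 ler_norm.
have neg : 0 <= \int[mu]_(x in D) (EFin \o f)^\- x <= K%:E.
  rewrite integral_ge0//=; apply: le_trans hK; apply: le_inner_integral => // x Dx.
  apply: le_trans (fh x Dx); rewrite funenegE /= -EFin_max lee_fin.
  by rewrite ge_max normr_ge0 andbT -normrN ler_norm.
move: pos neg; set p := \int[mu]_(x in D) _; set n := \int[mu]_(x in D) _.
have finP z : 0 <= z <= K%:E -> exists2 r : R, z = r%:E & (0 <= r <= K)%R.
  move=> /andP[z0 zK]; have zfin : z \is a fin_num.
    by rewrite ge0_fin_numE// (le_lt_trans zK)// ltry.
  by exists (fine z); rewrite -?lee_fin fineK// z0.
move=> /finP[{}p -> /andP[p0 pK]] /finP[{}n -> /andP[n0 nK]] /=.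
by rewrite ler_norml; apply/andP; split; lra.
Qed.

End inner_integral.

Section displacement.
Context {R : realType} {d : nat}.
Local Notation E := 'rV[R]_d.
Local Notation Omega := (cadlag_path R d).
Variables (Q : E -> 'M[R]_d) (b : E -> E) (N : R.-sigmafker E ~> E).
Hypotheses (A1 : bounded_coefficients Q b) (A2 : bounded_levy_kernel N).

Lemma closed_set1_rV (x : E) : closed [set x].
Proof.
apply: accessible_closed_set1; apply: hausdorff_accessible.
exact: norm_hausdorff.
Qed.

Let measurable_min_sqnorm : measurable_fun setT (fun z : E => Num.min 1 (sqnorm z) : R).
Proof.
apply: measurable_minr; first exact: measurable_cst.
apply: continuous_measurable_rV.
rewrite (_ : @sqnorm R d = \sum_(i < d) (fun z : E => z 0 i * z 0 i)).
  elim/big_ind : _ => [|f g cf cg x|i _ x]; first exact: cst_continuous.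
    by apply: continuousD; [exact: cf|exact: cg].
  by apply: continuousM; exact: coord_continuous.
by apply/funext => z; rewrite fct_sumE.
Qed.

(** The bounds on the derivatives and on the Taylor remainder of [bump y] do not depend on [y]. The
    three terms of the constant belong to diffusion, drift and jumps. *)
Lemma levy_operator_bump_bounded :
  exists2 C : R, 0 <= C & forall y x, `|levy_operator Q b N (bump y) x| <= C.
Proof.
have [MQ MQP] : exists MQ : 'I_d -> 'I_d -> R,
    forall i j, 0 <= MQ i j /\ forall x, `|Q x i j| <= MQ i j.
  have h i j : exists M : R, 0 <= M /\ forall x, `|Q x i j| <= M.
    by have [M M0 MP] := bounded_funP (diffusion_bounded A1 i j); exists M.
  by exists (fun i j => sval (cid (h i j))) => i j; exact: svalP (cid (h i j)).
have [Mb MbP] : exists Mb : 'I_d -> R, forall i, 0 <= Mb i /\ forall x, `|b x 0 i| <= Mb i.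
  have h i : exists M : R, 0 <= M /\ forall x, `|b x 0 i| <= M.
    by have [M M0 MP] := bounded_funP (drift_bounded A1 i); exists M.
  by exists (fun i => sval (cid (h i))) => i; exact: svalP (cid (h i)).
have [K K0 KP] : exists2 K : R, 0 <= K &
    forall x, (\int[N x]_y (Num.min 1 (sqnorm y))%:E <= K%:E)%E.
  have := levy_kernel_bounded A2; set S := [set _ | _ in _] => supS.
  have le_sup x : (\int[N x]_y (Num.min 1 (sqnorm y))%:E <= ereal_sup S)%E.
    by apply: ereal_sup_ubound; exists x.
  have int0 x : (0 <= \int[N x]_y (Num.min 1 (sqnorm y))%:E)%E.
    apply: integral_ge0 => z _; rewrite lee_fin le_min ler01 /sqnorm /dotp.
    by apply: sumr_ge0 => i _; rewrite -expr2 sqr_ge0.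
  have sup0 := le_trans (int0 0) (le_sup 0).
  exists (fine (ereal_sup S)); first exact: fine_ge0.
  by move=> x; rewrite fineK// ge0_fin_numE.
exists (2^-1 * (\sum_(i < d) \sum_(j < d) MQ i j * 10) + \sum_(i < d) Mb i * 2 + d%:R * 3 * K).
  rewrite !addr_ge0 ?mulr_ge0//.
  - by apply: sumr_ge0 => i _; apply: sumr_ge0 => j _; rewrite mulr_ge0// (MQP i j).1.
  - by apply: sumr_ge0 => i _; rewrite mulr_ge0// (MbP i).1.
move=> y x; rewrite /levy_operator (le_trans (ler_normD _ _))// lerD//.
  rewrite (le_trans (ler_normD _ _))// lerD//.
    rewrite normrM ger0_norm// ler_wpM2l// /mxtrace.
    rewrite (le_trans (ler_norm_sum _ _ _))//; apply: ler_sum => i _.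
    rewrite mxE (le_trans (ler_norm_sum _ _ _))//; apply: ler_sum => j _.
    by rewrite normrM ler_pM// ?norm_hessian_bump// (MQP i j).2.
  rewrite /dotp (le_trans (ler_norm_sum _ _ _))//; apply: ler_sum => i _.
  by rewrite normrM ler_pM// ?norm_gradient_bump// (MbP i).2.
apply: (@norm_Rintegral_le _ _ _ _ _ _ (fun z => (d%:R * 3)%:E * (Num.min 1 (sqnorm z))%:E)%E).
  by move=> z _; rewrite -EFinM lee_fin -mulrA bump_taylor.
have min0 (z : E) : 0 <= Num.min 1 (sqnorm z).
  rewrite le_min ler01 /sqnorm /dotp.
  by apply: sumr_ge0 => i _; rewrite -expr2 sqr_ge0.
have m0 : measurable (~` [set 0 : E]).
  by apply: open_measurable_rV; apply: closed_openC; exact: closed_set1_rV.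
have mmin : measurable_fun setT (fun z : E => (Num.min 1 (sqnorm z))%:E).
  exact/measurable_EFinP.
rewrite ge0_integralZl//; last 2 first.
- exact: measurable_funTS.
- by move=> z _; rewrite lee_fin.
rewrite [leRHS]EFinM; apply: lee_wpmul2l; first by rewrite lee_fin mulr_ge0.
apply: le_trans (KP x); apply: ge0_subset_integral => //.
by move=> z _; rewrite lee_fin.
Qed.

Variable P : R.-pker E ~> Omega.
Hypothesis A4 : strong_markov_solution (levy_operator Q b N) P.

Lemma start_ae y : P y (~` [set w : Omega | w 0 = y]) = 0%E.
Proof.
have my : measurable [set w : Omega | w 0 = y].
  have := measurable_coordinate 0 measurableT (closed_measurable_rV (@closed_set1_rV y)).
  by rewrite setTI.
rewrite -[LHS]/(kernel_law P y _) probability_setC//.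
by rewrite [X in (1 - X)%E](solution_start A4) subee.
Qed.

(** The martingale of [bump y] has mean zero and [bump y] vanishes at the starting point, so the
    mean of [bump y] at time [t] is at most a constant times [t]. Markov's inequality is applied at
    the level [c] that [bump y] reaches outside of the ball of radius [e]. *)
Lemma displacement_bound (e : R) : 0 < e ->
  exists2 C : R, 0 <= C & forall y t, 0 <= t ->
    (P y [set w : Omega | (e < `|w t - y|)%R] <= (C * t)%:E)%E.
Proof.
move=> e0; have [C C0 CP] := levy_operator_bump_bounded.
pose c := e ^+ 2 / (1 + e ^+ 2).
have c0 : 0 < c by rewrite divr_gt0 ?exprn_gt0// ltr_pwDl// sqr_ge0.
exists (C / c); first by rewrite divr_ge0// ltW.
move=> y t t0; pose f := bump y.
have [_ Mint Mmart] := solution_martingale A4 y (C2b_bump y).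
have cf : continuous f by have [[[]]] := C2b_bump y.
have mf s : measurable_fun setT (fun w : Omega => f (w s)).
  exact: (measurableT_comp (continuous_measurable_rV cf) (measurable_coordinate s)).
have intf s : (P y).-integrable setT (fun w : Omega => (f (w s))%:E).
  apply: (@measurable_bounded_integrable _ _ _ (kernel_law P y) (fun w : Omega => f (w s))) => //.
    by rewrite ltey_eq fin_num_measure.
  have [_ fbnd] : C0b f by have [[]] := C2b_bump y.
  have [M M0 fM] := bounded_funP fbnd.
  by apply: (@bounded_fun_le _ _ _ M) => w; exact: fM.
have EM : \int[P y]_w mp_process (levy_operator Q b N) f t w = 0.
  rewrite (Mmart 0 t setT)//; last exact: (@measurableT _ (g_sigma_algebraType _)).
  rewrite /Rintegral integral0_eq// => w _.
  by rewrite /mp_process subrr set_itv1 /Rintegral integral_set1 subrr.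
pose M w := mp_process (levy_operator Q b N) f t w.
have intM : (P y).-integrable setT (EFin \o M) by exact: Mint.
have E0 : (\int[P y]_w (f (w 0))%:E = 0)%E.
  rewrite -(@integral0 _ _ _ (P y) setT); apply: ae_eq_integral => //.
    exact/measurable_EFinP.
  exists (~` [set w : Omega | w 0 = y]); split => //.
  - by apply: measurableC; have := measurable_coordinate 0 measurableT
      (closed_measurable_rV (@closed_set1_rV y)); rewrite setTI.
  - exact: start_ae.
  - by move=> w /= nw wy; apply: nw => _; rewrite wy /f bump_center.
have fM (w : Omega) : f (w t) <= M w + f (w 0) + C * t.
  rewrite /M /mp_process; set I := Rintegral _ _ _.
  suff : `|I| <= C * t by rewrite ler_norml => /andP[_ ?]; lra.
  apply: (@norm_Rintegral_le _ _ _ _ _ _ (fun=> C%:E)) => [r _|].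
    by rewrite lee_fin CP.
  rewrite integral_cst//= lebesgue_measure_itv/= lte_fin.
  case: ltP => _; last by rewrite mule0 lee_fin mulr_ge0.
  by rewrite -EFinD subr0 -EFinM.
have Ef : (\int[P y]_w (f (w t))%:E <= (C * t)%:E)%E.
  have intMf : (P y).-integrable setT (fun w => (M w)%:E + (f (w 0))%:E)%E.
    exact: integrableD.
  have intC : (P y).-integrable setT (EFin \o cst (C * t)).
    exact: (@finite_measure_integrable_cst _ _ _ (kernel_law P y)).
  apply: (@le_trans _ _ (\int[P y]_w ((M w)%:E + (f (w 0))%:E + (C * t)%:E))%E).
    apply: le_integral => //; first exact: integrableD.
    by move=> w _; rewrite -!EFinD lee_fin.
  rewrite integralD// integralD// E0 adde0 integral_cst// prob_kernel mule1.
  have -> : (\int[P y]_w (M w)%:E = 0)%E; last by rewrite add0e.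
  by rewrite -[LHS]fineK ?integrable_fin_num//; congr EFin.
apply: (@le_trans _ _ (P y [set w : Omega | (c%:E <= (f (w t))%:E)%E])).
  apply: le_measure; rewrite ?inE.
  - apply: measurable_far; [exact: ltW|exact: measurable_coordinate|exact: measurable_cst].
  - rewrite -[X in measurable X]setTI; apply: emeasurable_fun_c_infty => //.
    exact/measurable_EFinP.
  - by move=> w /= ew; rewrite lee_fin; exact: bump_far.
apply: (@markov_inequality _ _ _ _ (fun w : Omega => (f (w t))%:E)) => //.
- exact/measurable_EFinP.
- by move=> w; rewrite lee_fin bump_ge0.
- by rewrite (_ : c * _ = C * t)//; field; exact: lt0r_neq0.
Qed.

End displacement.

Section near_sets.
Context d (T : measurableType d) (R : realType) (mu : {measure set T -> \bar R}).
Variable G : (set T)^nat.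
Hypothesis mG : forall p, measurable (G p).

Let nearE : [set x | \forall p \near \oo, G p x] =
  \bigcup_k \bigcap_(p in [set p | (k <= p)%N]) G p.
Proof.
apply/seteqP; split => [x [k _ kG]|x [k _ kG]]; exists k => // p; exact: kG.
Qed.

Let mcap k : measurable (\bigcap_(p in [set p | (k <= p)%N]) G p).
Proof. by apply: bigcap_measurable => //; exists k => /=. Qed.

Lemma measurable_near : measurable [set x | \forall p \near \oo, G p x].
Proof. by rewrite nearE; exact: bigcupT_measurable. Qed.

(** Fatou's lemma for the lower limit of a sequence of sets. *)
Lemma measure_near_le (c : \bar R) : (forall p, mu (G p) <= c)%E ->
  (mu [set x | \forall p \near \oo, G p x] <= c)%E.
Proof.
move=> Gc; rewrite nearE; set B := fun k => \bigcap_(p in [set p | (k <= p)%N]) G p.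
have ndB : nondecreasing_seq B.
  move=> k l kl; apply/subsetPset => x Bx p /= lp; apply: Bx.
  exact: leq_trans kl lp.
have cvgB := nondecreasing_cvg_mu (mu := mu) mcap (bigcupT_measurable _ mcap) ndB.
rewrite -(cvg_lim _ cvgB)//; apply: lime_le; first by apply/cvg_ex; eexists; exact: cvgB.
near=> k; apply: le_trans (Gc k); apply: le_measure; rewrite ?inE//.
by move=> x /(_ k); apply => /=.
Unshelve. all: by end_near. Qed.

End near_sets.

(** * The Markov property at fixed and at discretized random times *)

Section markov_property.
Context {R : realType} {d : nat}.
Local Notation E := 'rV[R]_d.
Local Notation Omega := (cadlag_path R d).
Variable P : R.-pker E ~> Omega.
Hypothesis SM : strong_markov P.
Implicit Types (t : R) (x : E) (F C : set Omega).

Lemma markov_property t x F C : 0 <= t -> natural_filtration t F -> measurable C ->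
  P x (F `&` [set w : Omega | C (shift_path t w)]) = (\int[P x]_(w in F) P (w t) C)%E.
Proof.
move=> t0 tF mC; have Tstop : @stopping_time R d (fun=> t%:E).
  split => [w|s s0]; first by rewrite lee_fin.
  have [ts|ts] := leP t s.
    rewrite (_ : mkset _ = setT); first exact: (@measurableT _ (g_sigma_algebraType _)).
    by apply/seteqP; split => // w _ /=; rewrite lee_fin.
  rewrite (_ : mkset _ = set0); first exact: (@measurable0 _ (g_sigma_algebraType _)).
  by apply/seteqP; split => // w /=; rewrite lee_fin leNgt ts.
have FT : stopped_sigma_algebra (fun=> t%:E) F.
  split; first exact: natural_filtration_measurable tF.
  move=> s s0; have [ts|ts] := leP t s.
    rewrite (_ : _ `&` _ = F); first exact: natural_filtration_le tF.
    by apply/seteqP; split => [w []//|w Fw]; split => //=; rewrite lee_fin.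
  rewrite (_ : _ `&` _ = set0); first exact: (@measurable0 _ (g_sigma_algebraType _)).
  by apply/seteqP; split => // w [_] /=; rewrite lee_fin leNgt ts.
have := SM Tstop x FT mC => /=.
rewrite (_ : [set _ : Omega | (t%:E < +oo)%E] = setT) ?setIT//.
by apply/seteqP; split => // w _ /=; rewrite ltry.
Qed.

(** [F i] plays the event that a countably valued stopping time equals [t i]. These events are
    disjoint, so their probabilities sum to at most 1 and the uniform bound [c] survives. *)
Lemma markov_bigcup (F C : (set Omega)^nat) (t : nat -> R) (c : R) x :
  (forall i, 0 <= t i) -> (forall i, natural_filtration (t i) (F i)) ->
  trivIset setT F -> (forall i, measurable (C i)) ->
  (forall i y, (P y (C i) <= c%:E)%E) ->
  (P x (\bigcup_i (F i `&` [set w : Omega | C i (shift_path (t i) w)])) <= c%:E)%E.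
Proof.
move=> t0 tF trF mC PC.
have c0 : (0 <= c%:E)%E by apply: le_trans (PC 0 x).
have mF i : measurable (F i) by exact: natural_filtration_measurable (tF i).
have mS i : measurable [set w : Omega | C i (shift_path (t i) w)].
  by have := measurable_shift_path (t0 i) measurableT (mC i); rewrite setTI.
rewrite measure_bigcup//; last 2 first.
- by move=> i _; exact: measurableI.
- exact: trivIset_setIr.
apply: (@le_trans _ _ (\sum_(0 <= i <oo) (c%:E * P x (F i))))%E.
  rewrite (eq_eseriesl (Q := xpredT)); last by move=> i; rewrite in_setT.
  apply: lee_nneseries => // i _; rewrite markov_property//.
  rewrite -integral_cst//; exact: le_inner_integral.
rewrite nneseriesZl//.
rewrite -[leRHS]mule1; apply: lee_wpmul2l => //.
have := measure_bigcup (P x) setT F (fun i _ => mF i) trF.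
rewrite (eq_eseriesl (Q := xpredT)); last by move=> i; rewrite in_setT.
move=> <-; rewrite -[leLHS]/(kernel_law P x _) probability_le1//.
exact: bigcupT_measurable.
Qed.

End markov_property.

(** * From displacements at a fixed time to oscillations over an interval *)

Section oscillation.
Context {R : realType} {d : nat}.
Local Notation E := 'rV[R]_d.
Local Notation Omega := (cadlag_path R d).
Variables (Q : E -> 'M[R]_d) (b : E -> E) (N : R.-sigmafker E ~> E).
Hypotheses (A1 : bounded_coefficients Q b) (A2 : bounded_levy_kernel N).
Variable P : R.-pker E ~> Omega.
Hypothesis A4 : strong_markov_solution (levy_operator Q b N) P.

Definition oscillates (h e : R) : set Omega :=
  [set w : Omega | exists q : rat,
    0 <= (ratr q : R) < h /\ e < `|w (ratr q) - w 0|].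

Lemma measurable_path_far (e s u : R) : 0 <= e ->
  measurable [set w : Omega | e < `|w s - w u|].
Proof. by move=> e0; apply: measurable_far => //; exact: measurable_coordinate. Qed.

Lemma measurable_oscillates (h e : R) : 0 <= e -> measurable (oscillates h e).
Proof.
move=> e0; rewrite (_ : oscillates h e = \bigcup_(q : rat)
    (if 0 <= (ratr q : R) < h then [set w : Omega | e < `|w (ratr q) - w 0|] else set0)).
  apply: bigcupT_measurable_rat => q; case: ifP => // _.
  exact: measurable_path_far.
apply/seteqP; split => [w [q [qh ew]]|w [q _]]; first by exists q => //; rewrite qh.
by case: ifP => // qh ew; exists q.
Qed.

(** Measuring from [w 0] instead of [y] makes the event depend on the path alone, as needed after a
    shift. *)
Let displacement0 (e : R) : 0 < e -> exists2 C : R, 0 <= C & forall y t, 0 <= t ->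
  (P y [set w : Omega | (e < `|w t - w 0|)%R] <= (C * t)%:E)%E.
Proof.
move=> e0; have [C C0 CP] := displacement_bound A1 A2 A4 e0.
exists C => // y t t0; apply: le_trans (CP y t t0).
have m1 : measurable [set w : Omega | e < `|w t - w 0|].
  exact: (measurable_path_far _ _ (ltW e0)).
have m2 : measurable [set w : Omega | e < `|w t - y|].
  apply: measurable_far; [exact: ltW|exact: measurable_coordinate|exact: measurable_cst].
have m3 : measurable (~` [set w : Omega | w 0 = y]).
  apply: measurableC; have := measurable_coordinate 0 measurableT
    (closed_measurable_rV (@closed_set1_rV R d y)).
  by rewrite setTI.
apply: (@le_trans _ _ (P y ([set w : Omega | e < `|w t - y|] `|` ~` [set w : Omega | w 0 = y]))).
  apply: le_measure; rewrite ?inE//; first exact: measurableU.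
  move=> w /= ew; have [w0|] := pselect (w 0 = y); last by right.
  by left; rewrite -w0.
apply: (le_trans (measureU2 _ m2 m3)).
by rewrite [X in (_ + X)%E](start_ae A4) adde0.
Qed.

Let mark (h : R) (p i : nat) : R := i.+1%:R * h / p.+1%:R.

(* Ottaviani's inequality on the grid [mark h p]: either the path is still far
   from [w 0] at time [h], or it has moved back after the first far grid time. *)
Let grid_oscillation (e C h : R) (p : nat) y : 0 < h -> 0 < e ->
  (forall y t, 0 <= t ->
    (P y [set w : Omega | (e < `|w t - w 0|)%R] <= (C * t)%:E)%E) -> 0 <= C ->
  (P y (\bigcup_(i in [set i | (i <= p)%N])
      [set w : Omega | (e + e < `|w (mark h p i) - w 0|)%R]) <= (2 * C * h)%:E)%E.
Proof.
move=> h0 e0 CP C0.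
pose B i := if (i <= p)%N then [set w : Omega | e + e < `|w (mark h p i) - w 0|] else set0.
(* An event for the path shifted by [mark h p i]: it moves by more than [e] in the time that remains
   until [h]. A path that is [e + e] away at the mark and within [e] of [w 0] at time [h] must do
   so. *)
pose D i := if (i <= p)%N then [set w : Omega | e < `|w (h - mark h p i) - w 0|] else set0.
have mark0 i : 0 <= mark h p i by rewrite divr_ge0// mulr_ge0// ltW.
have mark_le i : (i <= p)%N -> mark h p i <= h.
  by move=> ip; rewrite /mark ler_pdivrMr// mulrC ler_wpM2l ?ler_nat// ltW.
have mB i : measurable (B i).
  by rewrite /B; case: ifP => // _; apply: measurable_path_far; rewrite addr_ge0// ltW.
have FB i : natural_filtration (mark h p i) (B i).
  rewrite /B; case: ifP => _; last first.
    exact: (@measurable0 _ (g_sigma_algebraType (cylinders `[0, mark h p i]))).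
  apply: (@measurable_far _ _ _ (g_sigma_algebraType (cylinders `[0, mark h p i]))).
  - by rewrite addr_ge0// ltW.
  - exact: adapted_coordinate.
  - exact: adapted_coordinate.
have mD i : measurable (D i).
  by rewrite /D; case: ifP => // _; apply: measurable_path_far; exact: ltW.
have PD i z : (P z (D i) <= (C * h)%:E)%E.
  rewrite /D; case: ifPn => ip; last by rewrite measure0 lee_fin mulr_ge0// ltW.
  apply: le_trans (CP z _ _) _; first by rewrite subr_ge0 mark_le.
  by rewrite lee_fin ler_wpM2l// lerBlDr lerDl.
have Fseq i : natural_filtration (mark h p i) (seqDU B i).
  apply: (@measurableD _ (g_sigma_algebraType (cylinders `[0, mark h p i]))).
    exact: FB.
  apply: (@bigsetU_measurable _ (g_sigma_algebraType (cylinders `[0, mark h p i]))) => j _.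
  apply: natural_filtration_le (FB j).
  by rewrite /mark ler_pM2r ?invr_gt0// ler_pM2r// ler_nat ltnS ltnW.
have := markov_bigcup (solution_strong_markov A4) y mark0 Fseq (@trivIset_seqDU _ B) mD PD.
set M := \bigcup_i _ => PM.
have mfar : measurable [set w : Omega | e < `|w h - w 0|].
  by apply: measurable_path_far; exact: ltW.
have mM : measurable M.
  apply: bigcupT_measurable => i; apply: measurableI.
    exact: natural_filtration_measurable (Fseq i).
  by have := measurable_shift_path (mark0 i) measurableT (mD i); rewrite setTI.
have -> : (2 * C * h)%:E = ((C * h)%:E + (C * h)%:E)%E by rewrite -EFinD; congr EFin; ring.
apply: (@le_trans _ _ (P y ([set w : Omega | e < `|w h - w 0|] `|` M))); last first.
  by apply: (le_trans (measureU2 _ mfar mM)); rewrite leeD// CP// ltW.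
apply: le_measure; rewrite ?inE; [|exact: measurableU|].
  apply: bigcup_measurable => i _; apply: measurable_path_far.
  by rewrite addr_ge0// ltW.
move=> w [j /= jp jw].
have [hw|hw] := ltP e `|w h - w 0|; [by left|right].
have : (\bigcup_i seqDU B i) w.
  by rewrite -seqDU_bigcup_eq; exists j => //; rewrite /B jp.
move=> [i _ Biw]; exists i => //; split => //.
have : B i w by exact: subset_seqDU Biw.
rewrite /B /D; case: ifP => // ip /= iw.
change (e < `|shift_path (mark h p i) w (h - mark h p i) - shift_path (mark h p i) w 0|).
rewrite shift_pathE ?subr_ge0 ?mark_le// shift_pathE// addr0 (addrC (mark _ _ _)) subrK.
have := ler_distD (w h) (w (mark h p i)) (w 0).
by rewrite (distrC (w h) (w (mark h p i))); lra.
Qed.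

Lemma oscillation_bound (e : R) : 0 < e ->
  exists2 C : R, 0 <= C & forall y h, 0 < h -> (P y (oscillates h e) <= (C * h)%:E)%E.
Proof.
move=> e0; have e20 : 0 < e / 2 by rewrite divr_gt0.
have [C C0 CP] := displacement0 e20.
exists (2 * C) => [|y h h0]; first by rewrite mulr_ge0.
pose G p := \bigcup_(i in [set i | (i <= p)%N])
  [set w : Omega | (e / 2 + e / 2 < `|w (mark h p i) - w 0|)%R].
have mG p : measurable (G p).
  by apply: bigcup_measurable => i _; apply: measurable_path_far; rewrite addr_ge0// ltW.
have GP p : (P y (G p) <= (2 * C * h)%:E)%E by exact: grid_oscillation.
apply: le_trans (measure_near_le mG GP); apply: le_measure; rewrite ?inE.
- by apply: measurable_oscillates; exact: ltW.
- exact: (measurable_near mG).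
move=> w [q [/andP[q0 qh] ew]] /=.
pose s : R := ratr q; have s0 : 0 <= s by [].
(* The first mark strictly after [s]. It has index at most [p] because [s < h], and these marks
   decrease to [s] closely enough for right continuity to carry over the strict inequality. *)
pose i p := Num.truncn (s * p.+1%:R / h).
have si p : (i p)%:R <= s * p.+1%:R / h < (i p).+1%:R.
  by apply: truncn_itv; apply: divr_ge0; [exact: mulr_ge0|exact: ltW].
have si' p : s < mark h p (i p) <= s + h / p.+1%:R.
  have p0 : 0 < p.+1%:R :> R by [].
  have /andP[ip1 ip2] := si p; rewrite /mark; apply/andP; split.
    by rewrite ltr_pdivlMr// -ltr_pdivrMr.
  rewrite ler_pdivrMr// mulrDl divfK ?gt_eqF// -natr1 mulrDl mul1r lerD2r.
  by rewrite -ler_pdivlMr.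
have ip p : (i p <= p)%N.
  rewrite -ltnS -(ltr_nat R); have /andP[ip1 _] := si p; apply: le_lt_trans ip1 _.
  by rewrite ltr_pdivrMr// mulrC ltr_pM2l.
have ws : w (mark h p (i p)) @[p --> \oo] --> w s.
  apply: (@cvg_comp _ _ _ (fun p => mark h p (i p)) w _ s^'+ _ _ (@path_right R d w s)).
  exact: cvg_at_right_seq h0 si'.
have wsn : `|w (mark h p (i p)) - w 0| @[p --> \oo] --> `|w s - w 0|.
  by apply: cvg_norm; apply: cvgB; [exact: ws|exact: cvg_cst].
have ew' : e / 2 + e / 2 < `|w s - w 0| by rewrite -splitr.
have [k _ kG] := cvgr_gt _ wsn _ ew'.
by exists k => // p kp; exists (i p); [exact: ip|exact: kG].
Qed.

End oscillation.

(** * Survival in D *)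

Section one_sided_neighbourhoods.
Context {R : realType}.
Implicit Types (A : set R) (r s : R).

Lemma near_leftE A r : (\forall s \near r^'-, A s) ->
  exists2 e, 0 < e & forall s, r - e < s < r -> A s.
Proof.
move=> [e /= e0 eA]; exists e => // s /andP[rs sr]; apply: eA => //=.
by rewrite gtr0_norm ?subr_gt0// ltrBlDr -ltrBlDl.
Qed.

Lemma near_rightE A r : (\forall s \near r^'+, A s) ->
  exists2 e, 0 < e & forall s, r < s < r + e -> A s.
Proof.
move=> [e /= e0 eA]; exists e => // s /andP[rs sr]; apply: eA => //=.
by rewrite ltr0_norm ?subr_lt0// opprB ltrBlDl.
Qed.

End one_sided_neighbourhoods.

Section exceptional_paths.
Context {R : realType} {d : nat}.
Local Notation E := 'rV[R]_d.
Local Notation Omega := (cadlag_path R d).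
Variable D : set E.
Hypothesis oD : open D.
Implicit Types (w : Omega) (r s t : R).

(* A Borel substitute for [t < exit_time D w], cf. [exceptional_path]. *)
Definition alive (t : R) (w : Omega) : Prop :=
  exists n, forall r, 0 <= r <= t -> erosion D n (w r).

Definition early_exit (n p i : nat) : set Omega :=
  [set w | exists q : rat, 0 <= (ratr q : R) < i.+1%:R / p.+1%:R /\
    ~ erosion D n (w (ratr q))].

(* The first grid time [i.+1 / p.+1] after the exit from [erosion D n] is
   followed by a displacement of size [k.+1^-1] within time [j.+1^-1]. *)
Definition crossing (k j n p : nat) : set Omega :=
  \bigcup_i (seqDU (early_exit n p) i `&`
    [set w | oscillates j.+1%:R^-1 k.+1%:R^-1 (shift_path (i.+1%:R / p.+1%:R) w)]).

(** The size of the jump is fixed by [k] before the window [j] shrinks. The lower limits in [n] and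
    then [p] keep any bound on [crossing k j n p] that is uniform in [n] and [p]. *)
Definition exceptional : set Omega :=
  \bigcup_k \bigcap_j
    [set w | \forall n \near \oo, \forall p \near \oo, crossing k j n p w].

Let grid_ge0 i p : 0 <= i.+1%:R / p.+1%:R :> R.
Proof. by rewrite divr_ge0. Qed.

Let adapted_early_exit n p i :
  natural_filtration (i.+1%:R / p.+1%:R) (early_exit n p i).
Proof.
pose T := g_sigma_algebraType (@cylinders R d `[0, i.+1%:R / p.+1%:R]).
rewrite (_ : early_exit n p i = \bigcup_(q : rat)
    (if 0 <= (ratr q : R) < i.+1%:R / p.+1%:R then
       [set w : Omega | (~` erosion D n) (w (ratr q))] else set0)).
  apply: (@bigcupT_measurable_rat _ T) => q; case: ifPn => [/andP[q0 qi]|_].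
    apply: natural_filtration_cylinder => //; first exact: ltW.
    by apply: measurableC; apply: closed_measurable_rV; exact: closed_erosion.
  exact: (@measurable0 _ T).
apply/seteqP; split => [w [q [qi nq]]|w [q _]]; first by exists q => //; rewrite qi.
by case: ifP => // qi nq; exists q.
Qed.

Let adapted_seqDU n p i :
  natural_filtration (i.+1%:R / p.+1%:R) (seqDU (early_exit n p) i).
Proof.
pose T := g_sigma_algebraType (@cylinders R d `[0, i.+1%:R / p.+1%:R]).
apply: (@measurableD _ T); first exact: adapted_early_exit.
apply: (@bigsetU_measurable _ T) => j _.
have ji : (j : nat).+1%:R / p.+1%:R <= i.+1%:R / p.+1%:R :> R.
  by rewrite ler_pM2r ?invr_gt0// ler_nat ltnS ltnW.
exact: (natural_filtration_le ji (@adapted_early_exit n p j)).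
Qed.

Let measurable_crossing k j n p : measurable (crossing k j n p).
Proof.
apply: bigcupT_measurable => i; apply: measurableI.
  exact: natural_filtration_measurable (@adapted_seqDU n p i).
have mo : measurable (@oscillates R d j.+1%:R^-1 k.+1%:R^-1).
  exact: measurable_oscillates.
by have := measurable_shift_path (grid_ge0 i p) measurableT mo; rewrite setTI.
Qed.

Lemma measurable_exceptional : measurable exceptional.
Proof.
apply: bigcupT_measurable => k; apply: bigcapT_measurable => j.
by apply: measurable_near => n; exact: measurable_near.
Qed.

(** For fixed [k], [markov_bigcup] and [oscillation_bound] bound the probability of
    [crossing k j n p] by a constant times [j.+1^-1], whatever [n] and [p]; then [j] is
    arbitrary. *)
Lemma exceptional_null (Q : E -> 'M[R]_d) (b : E -> E) (N : R.-sigmafker E ~> E)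
    (P : R.-pker E ~> Omega) :
  bounded_coefficients Q b -> bounded_levy_kernel N ->
  strong_markov_solution (levy_operator Q b N) P ->
  forall x, P x exceptional = 0%E.
Proof.
move=> A1 A2 A4 x.
pose B k j := [set w | \forall n \near \oo, \forall p \near \oo, crossing k j n p w].
have mB k j : measurable (B k j).
  by apply: measurable_near => n; exact: measurable_near.
apply/eqP; rewrite -measure_le0.
apply: (le_trans (measure_sigma_subadditive _ _ _ (@subset_refl _ _))).
- by move=> k; apply: bigcapT_measurable => j; exact: mB.
- exact: measurable_exceptional.
rewrite eseries0// => k _ _; apply/eqP; rewrite -measure_le0.
have k0 : 0 < k.+1%:R^-1 :> R by rewrite invr_gt0.
have [C C0 CP] := oscillation_bound A1 A2 A4 k0.
have PB j : (P x (B k j) <= (C * j.+1%:R^-1)%:E)%E.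
  apply: (@measure_near_le _ _ _ (P x)
      (fun n => [set w | \forall p \near \oo, crossing k j n p w])) => n.
    exact: measurable_near.
  apply: (@measure_near_le _ _ _ (P x) (crossing k j n)) => p.
    exact: measurable_crossing.
  apply: (@markov_bigcup _ _ _ (solution_strong_markov A4) (seqDU (early_exit n p))
      (fun=> oscillates j.+1%:R^-1 k.+1%:R^-1) (fun i => i.+1%:R / p.+1%:R)).
  - by move=> i; exact: grid_ge0.
  - by move=> i; exact: adapted_seqDU.
  - exact: trivIset_seqDU.
  - by move=> i; exact: measurable_oscillates.
  - by move=> i y; apply: CP; rewrite invr_gt0.
apply/lee_addgt0Pr => e e0; rewrite add0e.
pose j := Num.truncn (C / e).
apply: (@le_trans _ _ (P x (B k j))).
  apply: le_measure; rewrite ?inE//.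
    by apply: bigcapT_measurable => i; exact: mB.
  by move=> w /(_ j Logic.I).
apply: (le_trans (PB j)); rewrite lee_fin ler_pdivrMr// mulrC -ler_pdivrMr//.
by rewrite ltW// truncnS_gt.
Qed.

Lemma alive_le s t w : s <= t -> alive t w -> alive s w.
Proof.
move=> st [n nw]; exists n => r /andP[r0 rs]; apply: nw.
by rewrite r0 (le_trans rs).
Qed.

Lemma alive0 w : D (w 0) -> alive 0 w.
Proof.
rewrite {1}(bigcup_erosion oD) => -[n _ nw]; exists n => r r0.
by rewrite (_ : r = 0)//; apply/eqP; rewrite eq_le andbC.
Qed.

Lemma alive_right t w : 0 <= t -> alive t w ->
  exists2 e, 0 < e & forall s, s < t + e -> alive s w.
Proof.
move=> t0 [n nw]; have wt : erosion D n (w t) by apply: nw; rewrite t0 lexx.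
have [e e0 eP] := near_rightE (path_right (erosion_nbhs wt)).
exists e => // s ste; exists n.+1 => r /andP[r0 rs].
have [rt|tr] := leP r t.
  by apply: (@erosion_le _ _ _ n n.+1) => //; apply: nw; rewrite r0.
by apply: eP; rewrite tr (le_lt_trans rs).
Qed.

(* On such a path the exit times from the sets [erosion D n] increase to a time
   [s <= t] without reaching it, so that [w] jumps at [s] back into [D] from a
   left limit outside of [D]. *)
Lemma exceptional_path t w : 0 <= t -> (forall r, 0 <= r <= t -> D (w r)) ->
  ~ alive t w -> exceptional w.
Proof.
move=> t0 wD nalive.
pose S := [set s | 0 <= s <= t /\ alive s w].
have S0 : S 0 by split; [rewrite lexx t0|apply: alive0; apply: wD; rewrite lexx t0].
have supS : has_sup S by split; [exists 0|exists t => s [/andP[]]].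
pose r := sup S.
have r0' : 0 <= r by apply: ub_le_sup; [case: supS|].
have rt : r <= t by apply: ge_sup; [exists 0|move=> s [/andP[]]].
have alive_lt s : s < r -> alive s w.
  move=> sr; have [u [_ uw] su] := sup_gt (let: conj a _ := supS in a) sr.
  exact: alive_le (ltW su) uw.
(* Survival at [r] would extend beyond [r] by [alive_right], against the choice of [r] as a supremum
   or against death by time [t]. *)
have nalive_r : ~ alive r w.
  move=> /(alive_right r0')[e e0 eP].
  have [tre|tre] := ltP t (r + e); first exact/nalive/eP.
  have : r + e / 2 <= r.
    apply: ub_le_sup; first by case: supS.
    split; last by apply: eP; rewrite ltrD2l ltr_pdivrMr// ltr_pMr// ltr1n.
    rewrite addr_ge0 ?divr_ge0 ?(ltW e0)//= (le_trans _ tre)//.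
    by rewrite lerD2l ler_pdivrMr// ler_pMr// ler1n.
  by rewrite gerDl leNgt divr_gt0.
have r0 : 0 < r.
  rewrite lt_neqAle r0' andbT; apply/eqP => r0.
  by apply: nalive_r; rewrite -r0; case: S0.
have wr : D (w r) by apply: wD; rewrite r0'.
have /cvg_ex[/= l wl] := path_left (w := w) (t := r).
(* Otherwise [[0, r]] splits into [[0, s0]], where the path survives, the open interval up to [r],
   where it is close to [l], and the point [r]. The largest of the three erosion indices would make
   the path alive at [r]. *)
have nDl : ~ D l.
  rewrite {1}(bigcup_erosion oD) => -[n _ /erosion_nbhs/wl/near_leftE[e e0 eP]].
  apply: nalive_r; pose s0 := Num.max 0 (r - e / 2).
  have s0r : s0 < r by rewrite gt_max r0 gtrBl divr_gt0.
  have [n1 n1P] := alive_lt _ s0r.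
  move: wr; rewrite {1}(bigcup_erosion oD) => -[n2 _ n2P].
  have le1 : (n1 <= maxn n1 (maxn n2 n.+1))%N by rewrite leq_maxl.
  have le2 : (n2 <= maxn n1 (maxn n2 n.+1))%N by rewrite !leq_max leqnn !orbT.
  have le3 : (n.+1 <= maxn n1 (maxn n2 n.+1))%N by rewrite !leq_max leqnn !orbT.
  exists (maxn n1 (maxn n2 n.+1)) => u /andP[u0].
  rewrite le_eqVlt => /predU1P[->|ur]; first exact: (erosion_le le2).
  have [us|su] := leP u s0; first by apply: (erosion_le le1); apply: n1P; rewrite u0.
  apply: (erosion_le le3); apply: eP; rewrite ur andbT (le_lt_trans _ su)//.
  by rewrite le_max lerD2l lerN2 ler_pdivrMr// ler_pMr// ler1n orbT.
have wrl : 0 < `|w r - l|.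
  by rewrite normr_gt0 subr_eq0; apply/eqP => wrl; apply: nDl; rewrite -wrl.
pose k := Num.truncn (2 / `|w r - l|).
have ek : k.+1%:R^-1 < `|w r - l| / 2.
  by rewrite invf_plt ?posrE ?divr_gt0// invf_div truncnS_gt.
set e := k.+1%:R^-1 in ek.
exists k => // j _.
have h0 : 0 < j.+1%:R^-1 :> R by rewrite invr_gt0.
have [e1 e10 e1P] : exists2 e1, 0 < e1 & forall s, r - e1 < s < r -> e < `|w r - w s|.
  have : \forall s \near r^'-, `|w r - w s| > e.
    have wsn : `|w r - w s| @[s --> r^'-] --> `|w r - l|.
      by apply: cvg_norm; apply: cvgB; [exact: cvg_cst|exact: wl].
    apply: cvgr_gt wsn _ _; apply: (lt_trans ek).
    by rewrite ltr_pdivrMr// ltr_pMr// ltr1n.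
  exact: near_leftE.
(* Every time strictly between [a] and [r] precedes the jump by less than [j.+1^-1] and is at
   distance more than [e] from [w r]. The path survives up to [a], so for [n >= n0] it leaves
   [erosion D n] only after [a]. *)
pose a := Num.max 0 (Num.max (r - e1) (r - j.+1%:R^-1)).
have ar : a < r by rewrite !gt_max r0 !gtrBl e10 h0.
have a0 : 0 <= a by rewrite le_max lexx.
have ae1 : r - e1 <= a by rewrite !le_max lexx !orbT.
have ah : r - j.+1%:R^-1 <= a by rewrite !le_max lexx !orbT.
have [n0 n0P] := alive_lt _ ar.
exists n0 => // n /= n0n.
have [e2 e20 e2P] : exists2 e2, 0 < e2 & forall s, r - e2 < s < r -> ~ erosion D n (w s).
  have ol : nbhs l (~` erosion D n).
    apply: open_nbhs_nbhs; split; first by apply: closed_openC; exact: closed_erosion.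
    by move=> nl; apply: nDl; exact: erosion_sub nl.
  exact: near_leftE (wl _ ol).
have [q /andP[aq qr] e2q] : exists2 q : rat, a < (ratr q : R) < r & r - e2 < ratr q.
  have ae2r : Num.max a (r - e2) < r by rewrite gt_max ar gtrBl e20.
  have [q] := rat_in_itvoo ae2r; rewrite in_itv/= gt_max => /andP[/andP[aq e2q] qr].
  by exists q => //; rewrite aq.
have wq : ~ erosion D n (w (ratr q)) by apply: e2P; rewrite e2q.
have q0 : 0 <= (ratr q : R) by rewrite (le_trans a0)// ltW.
near=> p.
have p0 : 0 < p.+1%:R :> R by [].
have pq : p.+1%:R^-1 < r - ratr q.
  by near: p; apply: (near_infty_natSinv_lt (PosNum (_ : 0 < r - ratr q))); rewrite subr_gt0.
pose i0 := Num.truncn (ratr q * p.+1%:R : R).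
have i0P : i0%:R <= (ratr q * p.+1%:R : R) < i0.+1%:R.
  by apply: truncn_itv; rewrite mulr_ge0.
have /andP[i0q qi0] := i0P.
have ti0r : i0.+1%:R / p.+1%:R < r.
  apply: (@le_lt_trans _ _ (ratr q + p.+1%:R^-1)); last by rewrite -ltrBrDl.
  by rewrite ler_pdivrMr// mulrDl mulVf ?gt_eqF// -natr1 lerD2r.
have early0 : early_exit n p i0 w by exists q; rewrite q0 ltr_pdivlMr.
have [i _ iw] : (\bigcup_i seqDU (early_exit n p) i) w.
  by rewrite -seqDU_bigcup_eq; exists i0.
have ii0 : (i <= i0)%N.
  rewrite leqNgt; apply/negP => i0i; case: iw => _; apply.
  by rewrite -bigcup_mkord; exists i0.
exists i => //; split => //.
(* The first grid time after the exit lies between [a] and [r]: the exit comes after [a], and the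
   grid time following [ratr q] is still before [r]. *)
pose t1 : R := i.+1%:R / p.+1%:R.
have t10 : 0 <= t1 by exact: grid_ge0.
have t1r : t1 < r.
  by apply: le_lt_trans ti0r; rewrite ler_pM2r ?invr_gt0// ler_nat ltnS.
have at1 : a < t1.
  case: iw => -[q' [/andP[q'0 q't1] nq'] _]; rewrite ltNge; apply/negP => t1a.
  apply: nq'; apply: (erosion_le n0n); apply: n0P.
  by rewrite q'0 (le_trans (ltW q't1)).
have ewt1 : e < `|w r - w t1| by apply: e1P; rewrite t1r andbT (le_lt_trans ae1).
have [e3 e30 e3P] : exists2 e3, 0 < e3 & forall s, r < s < r + e3 -> e < `|w s - w t1|.
  apply: near_rightE.
  have wsn : `|w s - w t1| @[s --> r^'+] --> `|w r - w t1|.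
    by apply: cvg_norm; apply: cvgB; [exact: path_right|exact: cvg_cst].
  exact: cvgr_gt wsn _ ewt1.
(* [oscillates] asks for a rational lag, so [q1] slightly exceeds [r - t1]; right continuity at [r]
   preserves the displacement. *)
have rt1 : r - t1 < Num.min j.+1%:R^-1 (r - t1 + e3).
  by rewrite lt_min ltrDl e30 andbT ltrBlDl -ltrBlDr (le_lt_trans ah).
have [q1] := rat_in_itvoo rt1; rewrite in_itv/= lt_min => /andP[q1l /andP[q1h q1e]].
have q10 : 0 <= (ratr q1 : R) by rewrite (le_trans _ (ltW q1l))// subr_ge0 ltW.
exists q1; split; first by rewrite q10.
change (e < `|shift_path t1 w (ratr q1) - shift_path t1 w 0|).
rewrite !shift_pathE// addr0; apply: e3P.
by rewrite -ltrBlDl q1l /= -ltrBrDl addrAC.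
Unshelve. all: by end_near. Qed.

End exceptional_paths.

(** * Measurability of survival and comparison with the exit time *)

Section killed_paths.
Context {R : realType} {d : nat}.
Local Notation E := 'rV[R]_d.
Local Notation Omega := (cadlag_path R d).
Variable D : set E.
Hypothesis oD : open D.
Implicit Types (w : Omega) (r s t : R).

(** Rational multiples of [t] include the end point [t] itself, which right continuity could not
    reach from earlier times, and they keep the condition jointly measurable in the path and [t]. *)
Lemma alive_ratE t w : 0 <= t -> alive D t w <->
  exists n, forall q : rat, 0 <= (ratr q : R) <= 1 -> erosion D n (w (t * ratr q)).
Proof.
move=> t0; split=> -[n nw]; exists n.
  by move=> q /andP[q0 q1]; apply: nw; rewrite mulr_ge0// ler_piMr.
move=> r /andP[r0]; rewrite le_eqVlt => /predU1P[->|rt].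
  by rewrite -[t]mulr1 -(rmorph1 (ratr : rat -> R)); apply: nw; rewrite rmorph1 ler01 lexx.
have {}t0 : 0 < t by exact: le_lt_trans rt.
apply: contrapT => nr.
have [e e0 eP] : exists2 e, 0 < e & forall s, r < s < r + e -> ~ erosion D n (w s).
  have ol : nbhs (w r) (~` erosion D n).
    apply: open_nbhs_nbhs; split => //.
    by apply: closed_openC; exact: closed_erosion.
  exact: near_rightE (path_right ol).
have rt' : r / t < Num.min 1 ((r + e) / t).
  by rewrite lt_min ltr_pdivrMr// mul1r rt ltr_pM2r ?invr_gt0// ltrDl.
have [q] := rat_in_itvoo rt'; rewrite in_itv/= lt_min => /andP[rq /andP[q1 qe]].
apply: (eP (t * ratr q)); last first.
  by apply: nw; rewrite (ltW q1) andbT (le_trans _ (ltW rq))// divr_ge0// ltW.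
by rewrite mulrC -ltr_pdivrMr// rq -ltr_pdivlMr.
Qed.

(** The first clause is there because [alive] is vacuously true at negative times. *)
Definition alive_times : set (Omega * R) := [set z | 0 <= z.2 /\ alive D z.2 z.1].

Lemma measurable_alive_times : measurable alive_times.
Proof.
pose G n (q : rat) := if 0 <= (ratr q : R) <= 1 then
  [set z : Omega * R | ~ erosion D n (z.1 (z.2 * ratr q))] else set0.
rewrite (_ : alive_times = (setT `*` `[0, +oo[) `&` \bigcup_n ~` (\bigcup_q G n q)).
  apply: measurableI; first exact: measurableX.
  apply: bigcupT_measurable => n; apply: measurableC.
  apply: bigcupT_measurable_rat => q; rewrite /G; case: ifP => // _.
  have mq : measurable_fun setT (fun z : Omega * R => (z.1, z.2 * ratr q)).
    by apply: measurable_fun_pair => //; exact: measurable_funM.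
  have me : measurable (~` erosion D n).
    by apply: measurableC; apply: closed_measurable_rV; exact: closed_erosion.
  by have := measurableT_comp measurable_path_eval mq measurableT me; rewrite setTI.
apply/seteqP; split => [[w t] /= [t0 /(alive_ratE _ t0)[n nw]]|].
  split; first by split => //=; rewrite in_itv/= t0.
  by exists n => // -[q _]; rewrite /G; case: ifP => // q01 /=; apply; exact: nw.
move=> [w t] /= [[_ /=]]; rewrite in_itv/= andbT => t0 [n _ nG]; split => //.
apply/(alive_ratE _ t0); exists n => q q01; apply: contrapT => nq.
by apply: nG; exists q => //; rewrite /G q01.
Qed.

Lemma adapted_alive t : 0 <= t -> natural_filtration t [set w | alive D t w].
Proof.
move=> t0; pose T := g_sigma_algebraType (@cylinders R d `[0, t]).
pose G n (q : rat) := if 0 <= (ratr q : R) <= 1 then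
  [set w : Omega | (~` erosion D n) (w (t * ratr q))] else set0.
rewrite (_ : mkset _ = \bigcup_n ~` (\bigcup_q G n q)).
  apply: (@bigcupT_measurable _ T) => n; apply: (@measurableC _ T).
  apply: (@bigcupT_measurable_rat _ T) => q; rewrite /G; case: ifPn => [/andP[q0 q1]|_].
    apply: natural_filtration_cylinder; [exact: mulr_ge0|by rewrite ler_piMr|].
    by apply: measurableC; apply: closed_measurable_rV; exact: closed_erosion.
  exact: (@measurable0 _ T).
apply/seteqP; split => [w /(alive_ratE _ t0)[n nw]|w [n _ nG]].
  by exists n => // -[q _]; rewrite /G; case: ifP => // q01 /=; apply; exact: nw.
apply/(alive_ratE _ t0); exists n => q q01; apply: contrapT => nq.
by apply: nG; exists q => //; rewrite /G q01.
Qed.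

Lemma measurable_alive t : 0 <= t -> measurable [set w | alive D t w].
Proof. by move=> t0; apply: natural_filtration_measurable (adapted_alive t0). Qed.

Lemma alive_mem t w : 0 <= t -> alive D t w -> D (w t).
Proof. by move=> t0 [n nw]; apply: (@erosion_sub _ _ D n); apply: nw; rewrite t0 lexx. Qed.

Lemma alive_exit t w : 0 <= t -> alive D t w -> (t%:E < exit_time D w)%E.
Proof.
move=> t0 /(alive_right t0)[e e0 eP].
apply: (@lt_le_trans _ _ (t + e)%:E); first by rewrite lte_fin ltrDl.
apply: le_ereal_inf_tmp => _ [s [s0 nDs] <-]; rewrite lee_fin leNgt; apply/negP => ste.
by apply: nDs; apply: alive_mem; [exact: ltW|exact: eP].
Qed.

(** [exit_time] ignores time 0, which is why [D (w 0)] is assumed; at later times up to [t], leaving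
    D would contradict the infimum. *)
Lemma exit_alive t w : 0 <= t -> D (w 0) -> (t%:E < exit_time D w)%E ->
  ~ exceptional D w -> alive D t w.
Proof.
move=> t0 Dw0 tw; apply: contra_notP; apply: exceptional_path => // r /andP[r0 rt].
have [<-//|r0'] := eqVneq 0 r; apply: contrapT => nDr.
have : (exit_time D w <= r%:E)%E.
  by apply: ereal_inf_lbound; exists r => //; split => //; rewrite lt_neqAle r0'.
by apply/negP; rewrite -ltNge; apply: le_lt_trans tw; rewrite lee_fin.
Qed.

(** The multiplicativity that turns the Markov property of the process into that of the killed
    process. *)
Lemma alive_shift s t w : 0 <= s -> 0 <= t ->
  alive D (s + t) w <-> alive D s w /\ alive D t (shift_path s w).
Proof.
move=> s0 t0; split => [stw|[[n nw] [p pw]]].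
  split; first by apply: alive_le stw; rewrite lerDl.
  case: stw => n nw; exists n => r /andP[r0 rt]; rewrite shift_pathE//.
  by apply: nw; rewrite addr_ge0//= lerD2l.
exists (maxn n p) => r /andP[r0 rst]; have [rs|sr] := leP r s.
  by apply: (@erosion_le _ _ _ n); [exact: leq_maxl|apply: nw; rewrite r0].
apply: (@erosion_le _ _ _ p); first exact: leq_maxr.
have -> : r = s + (r - s) by rewrite addrC subrK.
rewrite -shift_pathE ?subr_ge0 ?(ltW sr)//; apply: pw.
by rewrite subr_ge0 (ltW sr) lerBlDl.
Qed.

End killed_paths.

Section killed_semigroup_alive.
Local Open Scope ereal_scope.

(** As [f] may fail to be measurable, [g] is raised to [+oo] on [Z]: the comparison with [f] then
    holds everywhere, and only the measurable [g] is changed on a null set. *)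
Lemma le_integral_off_null d (T : measurableType d) (R : realType)
    (mu : {measure set T -> \bar R}) (Z : set T) (f g : T -> \bar R) :
  measurable Z -> mu Z = 0 -> (forall x, 0 <= f x) -> (forall x, 0 <= g x) ->
  measurable_fun setT g -> (forall x, ~ Z x -> f x <= g x) ->
  \int[mu]_x f x <= \int[mu]_x g x.
Proof.
move=> mZ Z0 f0 g0 mg fg; pose h x := if x \in Z then +oo else g x.
have mh : measurable_fun setT h.
  apply: measurable_fun_if => //.
  - by apply: (measurable_fun_bool true); rewrite setTI preimage_mem_true.
  - exact: measurable_funTS.
apply: (@le_trans _ _ (\int[mu]_x h x)).
  apply: le_inner_integral => // x _; rewrite /h; case: ifPn => [_|]; first exact: leey.
  by rewrite notin_setE; exact: fg.
rewrite (ge0_ae_eq_integral (g := g))//.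
- by move=> x _; rewrite /h; case: ifP.
- exists Z; split => // x /= nxg; apply: contrapT => nZ; apply: nxg => _.
  by rewrite /h memNset.
Qed.

Context {R : realType} {d : nat}.
Local Notation E := 'rV[R]_d.
Local Notation Omega := (cadlag_path R d).
Variables (Q : E -> 'M[R]_d) (b : E -> E) (N : R.-sigmafker E ~> E).
Hypotheses (A1 : bounded_coefficients Q b) (A2 : bounded_levy_kernel N).
Variable P : R.-pker E ~> Omega.
Hypothesis A4 : strong_markov_solution (levy_operator Q b N) P.
Variable D : set E.
Hypothesis oD : open D.

Lemma killed_semigroupE (f : E -> R) (t : R) (x : E) : (0 <= t)%R -> D x ->
  measurable_fun D f -> (forall y, D y -> (0 <= f y)%R) ->
  killed_semigroup D P t f x = \int[P x]_(w in [set w | alive D t w]) (f (w t))%:E.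
Proof.
move=> t0 Dx mf f0; have mD := open_measurable_rV oD.
rewrite /killed_semigroup; set S := [set w : Omega | _ /\ _].
have mA := measurable_alive D t0.
have mfA : measurable_fun setT ((fun w : Omega => (f (w t))%:E) \_ [set w | alive D t w]).
  have mfA : measurable_fun [set w | alive D t w] (fun w : Omega => f (w t)).
    apply: (@measurable_comp _ _ _ _ _ _ D f) => //.
      by move=> _ [w wt <-]; exact: alive_mem wt.
    by apply: measurable_funTS; exact: measurable_coordinate.
  have mfA' : measurable_fun [set w | alive D t w] (fun w : Omega => (f (w t))%:E).
    exact/measurable_EFinP.
  exact: (measurable_restrictT _ mA).1 mfA'.
rewrite integral_mkcond [RHS]integral_mkcond; apply/eqP; rewrite eq_le; apply/andP; split.
  have m0 : measurable (~` [set w : Omega | w 0%R = x]).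
    apply: measurableC; have := measurable_coordinate 0%R measurableT
      (closed_measurable_rV (@closed_set1_rV R d x)).
    by rewrite setTI.
  have mZ := measurable_exceptional D.
  apply: (@le_integral_off_null _ _ _ _ (exceptional D `|` ~` [set w : Omega | w 0%R = x])) => //.
  - exact: measurableU.
  - apply/eqP; rewrite -measure_le0; apply: (le_trans (measureU2 _ mZ m0)).
    by rewrite [X in X + _](exceptional_null D A1 A2 A4) [X in _ + X](start_ae A4) adde0.
  - by apply: erestrict_ge0 => w [Dw _]; rewrite lee_fin f0.
  - by apply: erestrict_ge0 => w wt; rewrite lee_fin f0//; exact: alive_mem wt.
  - move=> w /not_orP[nw /contrapT w0]; rewrite !patchE.
    case: ifPn => [|_]; last first.
      by case: ifPn => // /set_mem wt; rewrite lee_fin f0//; exact: alive_mem wt.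
    rewrite inE => -[Dw tw]; rewrite mem_set//=.
    by apply: exit_alive => //; rewrite w0.
apply: le_inner_integral => w _.
  by apply: erestrict_ge0 => {}w wt; rewrite lee_fin f0//; exact: alive_mem wt.
rewrite !patchE; case: ifPn => [/set_mem wt|_]; last first.
  by case: ifPn => // /set_mem[Dw _]; rewrite lee_fin f0.
rewrite mem_set//; split; first exact: alive_mem wt.
exact: alive_exit.
Qed.

End killed_semigroup_alive.

(** * The resolvent as an occupation kernel *)

Section lebesgue_shift.
Local Open Scope ereal_scope.
Context {R : realType}.
Local Notation leb := (@lebesgue_measure R).

(** The image of Lebesgue measure under translation agrees with it on half-open intervals, hence
    everywhere. *)
Lemma integral_lebesgue_shift (s : R) (f : R -> \bar R) :
  measurable_fun setT f -> (forall r, 0 <= f r) ->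
  \int[leb]_(r in `[s, +oo[) f r = \int[leb]_(t in `[0%R, +oo[) f (s + t)%R.
Proof.
move=> mf f0.
have mphi : measurable_fun setT (fun t : measurableTypeR R => (s + t)%R : measurableTypeR R).
  exact: measurable_funD.
pose one0 := (fun _ => ler01) : forall t : measurableTypeR R, (0 <= (1%R : R))%R.
have shE : forall A, measurable A -> leb A =
    weighted_image leb one0 (measurable_cst _) mphi A.
  apply: lebesgue_measure_unique => _ [[a b]] _ <-.
  apply: etrans (esym (weighted_imageE leb one0 (measurable_cst _) mphi _)).
  transitivity (\int[leb]_t (\1_(`](a - s)%R, (b - s)%R]%classic) t)%:E).
    rewrite integral_indic ?setIT//= !lebesgue_measure_itv/= !lte_fin ltrD2r.
    by case: ifP => // _; rewrite -?EFinB; congr _%:E; ring.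
  apply: eq_integral.
  move=> t _; rewrite mul1r; congr (_%:E); rewrite !indicE; congr ((_ : bool)%:R).
  by apply/idP/idP; rewrite !inE/= !in_itv/= ltrBlDl lerBrDl.
rewrite integral_mkcond [RHS]integral_mkcond.
transitivity (\int[weighted_image leb one0 (measurable_cst _) mphi]_r (f \_ `[s, +oo[) r).
  by apply: eq_measure_integral => A mA _; exact: shE.
rewrite integral_weighted_image//; last 2 first.
- by apply: (measurable_restrictT _ _).1 => //; exact: measurable_funTS.
- by move=> r; apply: erestrict_ge0.
apply: eq_integral => t _; rewrite mul1e !patchE; congr (if _ then _ else _).
by apply/idP/idP; rewrite !inE/= !in_itv/= !andbT lerDl.
Qed.

Lemma integral_expR_tail (a : R) : (0 < a)%R ->
  \int[leb]_(t in `[0%R, +oo[) (expR (- a * t))%:E = (a^-1)%:E.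
Proof.
move=> a0; have := integral_exponential_pdf a0.
have a_ge0 := ltW a0.
have me : measurable_fun setT (fun t : R => (expR (- a * t))%:E).
  by apply/measurable_EFinP/measurableT_comp => //; exact: measurable_funM.
rewrite (_ : \int[leb]_x _ = a%:E * \int[leb]_(t in `[0%R, +oo[) (expR (- a * t))%:E).
  by move=> h; rewrite -[LHS]mul1e -(mulVf (lt0r_neq0 a0)) EFinM -muleA h mule1.
rewrite -ge0_integralZl//; last exact: (measurable_funTS me).
rewrite [RHS]integral_mkcond; apply: eq_integral => t _.
by rewrite /exponential_pdf !patchE; case: ifP => // _; rewrite EFinM.
Qed.

End lebesgue_shift.

Section occupation.
Local Open Scope ereal_scope.
Context {R : realType} {d : nat}.
Local Notation E := 'rV[R]_d.
Local Notation Omega := (cadlag_path R d).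
Local Notation leb := (@lebesgue_measure R).
Variable D : set E.
Variable P : R.-pker E ~> Omega.
Implicit Types (w : Omega) (s t alpha : R) (x y : E) (f : E -> \bar R).

Definition discount alpha (z : Omega * R) : R :=
  (expR (- alpha * z.2) * \1_(alive_times D) z)%R.

Lemma discount_ge0 alpha z : (0 <= discount alpha z)%R.
Proof. by rewrite mulr_ge0// expR_ge0. Qed.

Lemma measurable_discount alpha : measurable_fun setT (discount alpha).
Proof.
apply: measurable_funM; last exact: (measurable_indic (measurable_alive_times D)).
by apply: measurableT_comp => //; exact: measurable_funM.
Qed.

(** The kernel U_alpha of the killed process, as the image under evaluation of a weighted product of
    [P x] and Lebesgue measure. It is a measure by construction, and Tonelli gives both orders of
    integration. *)
Definition occupation alpha x :=
  weighted_image (kernel_law P x \x leb) (discount_ge0 alpha)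
    (measurable_discount alpha) (@measurable_path_eval R d).

HB.instance Definition _ alpha x := Measure.on (occupation alpha x).

Definition path_density alpha f (z : Omega * R) : \bar R :=
  (discount alpha z)%:E * f (z.1 z.2).

Lemma path_density_ge0 alpha f z : (forall y, 0 <= f y) ->
  0 <= path_density alpha f z.
Proof. by move=> f0; rewrite mule_ge0// lee_fin discount_ge0. Qed.

Lemma measurable_path_density alpha f : measurable_fun setT f ->
  measurable_fun setT (path_density alpha f).
Proof.
move=> mf; apply: emeasurable_funM.
  by have md := measurable_discount alpha; exact/measurable_EFinP.
exact: (measurableT_comp mf measurable_path_eval).
Qed.

Lemma path_density_lt0 alpha f w t : (t < 0)%R -> path_density alpha f (w, t) = 0.
Proof.
move=> t0; rewrite /path_density /discount indicE memNset ?mulr0 ?mul0e//.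
by move=> -[/=]; rewrite leNgt t0.
Qed.

Section fixed_function.
Variable f : E -> \bar R.
Hypotheses (mf : measurable_fun setT f) (f0 : forall y, 0 <= f y).

Let mJ alpha := measurable_path_density alpha mf.
Let J0 alpha z : 0 <= path_density alpha f z := path_density_ge0 alpha z f0.

Lemma integral_occupation alpha x : \int[occupation alpha x]_y f y =
  \int[P x]_w \int[leb]_t path_density alpha f (w, t).
Proof.
rewrite integral_weighted_image//.
exact: (@fubini_tonelli1 _ _ _ _ _ (kernel_law P x) leb _ (mJ alpha) (J0 alpha)).
Qed.

Lemma integral_occupation_swap alpha x : \int[occupation alpha x]_y f y =
  \int[leb]_t \int[P x]_w path_density alpha f (w, t).
Proof.
rewrite integral_occupation.
exact: (@fubini_tonelli _ _ _ _ _ (kernel_law P x) leb _ (mJ alpha) (J0 alpha)).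
Qed.

Lemma integral_path_density alpha x t : (0 <= t)%R ->
  \int[P x]_w path_density alpha f (w, t) =
  (expR (- alpha * t))%:E * \int[P x]_(w in [set w | alive D t w]) f (w t).
Proof.
move=> t0; have mft : measurable_fun [set w | alive D t w] (fun w : Omega => f (w t)).
  apply: measurable_funTS; apply: (measurableT_comp mf).
  exact: measurable_coordinate.
have e0 : 0 <= (expR (- alpha * t))%:E by rewrite lee_fin expR_ge0.
rewrite -(@ge0_integralZl _ _ _ (P x) _ (measurable_alive D t0) _ mft _
  (fun (w : Omega) _ => f0 (w t)) e0).
rewrite [RHS]integral_mkcond; apply: eq_integral => w _.
rewrite patchE /path_density /discount indicE; case: ifPn => [|wt].
  by rewrite inE => wt; rewrite mem_set// mulr1.
by rewrite memNset ?mulr0 ?mul0e// => -[_ wt']; move: wt; rewrite mem_set.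
Qed.

Lemma measurable_path_integral alpha :
  measurable_fun setT (fun w => \int[leb]_t path_density alpha f (w, t)).
Proof. exact: (@measurable_fun_fubini_tonelli_F _ _ _ _ _ leb _ (mJ alpha) (J0 alpha)). Qed.

Lemma measurable_integral_occupation alpha :
  measurable_fun setT (fun x => \int[occupation alpha x]_y f y).
Proof.
under eq_fun do rewrite integral_occupation.
apply: measurable_fun_integral_kernel => //.
- by move=> U mU; exact: measurable_kernel.
- by move=> w; exact: integral_ge0.
- exact: measurable_path_integral.
Qed.

End fixed_function.

Lemma measurable_occupation alpha B : measurable B ->
  measurable_fun setT (fun x => occupation alpha x B).
Proof.
move=> mB; have mI : measurable_fun setT (EFin \o (\1_B : E -> R)).
  exact/measurable_EFinP/measurable_indic.
have I0 y : 0 <= (EFin \o (\1_B : E -> R)) y by rewrite lee_fin.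
have := measurable_integral_occupation mI I0 alpha.
by under eq_fun do rewrite integral_indic// setIT.
Qed.

Lemma occupation_outside alpha x : occupation alpha x (~` D) = 0.
Proof.
rewrite [LHS]weighted_imageE integral0_eq// => -[w t] _ /=.
rewrite /discount indicE; have [|_] := boolP ((w, t) \in _); last by rewrite mulr0 mul0r.
rewrite inE => -[t0 wt]; rewrite indicE memNset ?mulr0//=.
by apply; exact: alive_mem wt.
Qed.

Lemma occupation_le alpha x B : (0 < alpha)%R -> measurable B ->
  occupation alpha x B <= (alpha^-1)%:E.
Proof.
move=> a0 mB; apply: (@le_trans _ _ (occupation alpha x setT)).
  by apply: le_measure; rewrite ?inE.
have c0 y : 0 <= (cst 1 : E -> \bar R) y by rewrite /= lee01.
have -> : occupation alpha x setT = \int[occupation alpha x]_y (cst 1 y).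
  by rewrite integral_cst// mul1e.
rewrite integral_occupation_swap// -integral_expR_tail// [leRHS]integral_mkcond.
apply: ge0_le_integral => //.
- by move=> t _; apply: integral_ge0 => w _; exact: (path_density_ge0 _ _ c0).
- apply: (@measurable_fun_fubini_tonelli_G _ _ _ _ _ (kernel_law P x)).
    exact: measurable_path_density.
  by move=> z; exact: (path_density_ge0 _ _ c0).
- apply: (measurable_restrictT _ _).1 => //; apply: measurable_funTS.
  by apply/measurable_EFinP/measurableT_comp => //; exact: measurable_funM.
move=> t _; rewrite patchE; case: ifPn => [t0|].
  apply: (@le_trans _ _ (\int[P x]_w (cst (expR (- alpha * t))%:E w))); last first.
    by rewrite integral_cst// prob_kernel mule1.
  apply: le_inner_integral => w _; first exact: (path_density_ge0 _ _ c0).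
  rewrite /path_density mule1 lee_fin /discount /= ler_piMr ?expR_ge0//.
rewrite notin_setE/= in_itv/= andbT => t0.
by rewrite integral0_eq// => w _; rewrite path_density_lt0// ltNge; exact/negP.
Qed.

End occupation.

(** * The Markov property for occupation measures *)

Section occupation_markov.
Local Open Scope ereal_scope.
Context {R : realType} {d : nat}.
Local Notation E := 'rV[R]_d.
Local Notation Omega := (cadlag_path R d).
Local Notation leb := (@lebesgue_measure R).
Variable P : R.-pker E ~> Omega.
Hypothesis SM : strong_markov P.

(** Restarting from the position at time [t] and shifting the path by [t] give the same measure on
    path space, by [markov_property] on sets; both sides integrate [Y] against it. *)
Lemma markov_functional (t : R) x (F : set Omega) (Y : Omega -> \bar R) :
  (0 <= t)%R -> natural_filtration t F -> measurable_fun setT Y -> (forall w, 0 <= Y w) ->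
  \int[P x]_(w in F) \int[P (w t)]_w' Y w' = \int[P x]_(w in F) Y (shift_path t w).
Proof.
move=> t0 tF mY Y0; have mF := natural_filtration_measurable tF.
have F0 : forall w : Omega, (0 <= \1_F w :> R)%R by [].
have mF' : measurable_fun setT (\1_F : Omega -> R) by exact: measurable_indic.
have mt : measurable_fun setT (fun w : Omega => w t) by exact: measurable_coordinate.
have ms : measurable_fun setT (shift_path t : Omega -> Omega) by exact: measurable_shift_path.
have mP B : measurable B -> measurable_fun setT (P ^~ B) by move=> mB; exact: measurable_kernel.
have eqm : forall B, measurable B -> B `<=` setT ->
    mixture (weighted_image (P x) F0 mF' mt) mP B = weighted_image (P x) F0 mF' ms B.
  move=> B mB _; rewrite [RHS](weighted_imageE (P x) F0 mF' ms B).
  rewrite [LHS](integral_weighted_image (P x) F0 mF' mt (mP B mB)); last by [].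
  transitivity (\int[P x]_(w in F) P (w t) B).
    rewrite [RHS]integral_mkcond; apply: eq_integral => w _.
    by rewrite patchE indicE; case: ifP; rewrite ?mul1e ?mul0e.
  rewrite -(markov_property SM)//.
  have mFB : measurable (F `&` [set w : Omega | B (shift_path t w)]).
    by apply: measurableI => //; have := ms measurableT B mB; rewrite setTI.
  rewrite -[X in P x X]setIT -integral_indic//; apply: eq_integral => w _.
  by rewrite indicI.
transitivity (\int[mixture (weighted_image (P x) F0 mF' mt) mP]_w' Y w').
  rewrite [RHS]integral_mixture// [RHS]integral_weighted_image//; last 2 first.
  - exact: measurable_fun_integral_kernel.
  - by move=> y; exact: integral_ge0.
  rewrite [LHS]integral_mkcond; apply: eq_integral => w _.
  by rewrite patchE indicE; case: ifP; rewrite ?mul1e ?mul0e.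
rewrite (eq_measure_integral _ eqm) integral_weighted_image//.
rewrite [RHS]integral_mkcond; apply: eq_integral => w _.
by rewrite patchE indicE; case: ifP; rewrite ?mul1e ?mul0e.
Qed.

Variable D : set E.
Variable f : E -> \bar R.
Hypotheses (mf : measurable_fun setT f) (f0 : forall y, 0 <= f y).
Local Notation J := (path_density D).

Lemma measurable_path_density_after (alpha s : R) : measurable_fun setT
  (fun z : Omega * R => (J alpha f \_ (setT `*` `[s, +oo[)) z).
Proof.
have mS : measurable ((setT : set Omega) `*` `[s, +oo[%classic) by exact: measurableX.
apply: (measurable_restrictT _ mS).1; apply: measurable_funTS.
exact: measurable_path_density.
Qed.

Lemma measurable_path_integral_after (alpha s : R) :
  measurable_fun setT (fun w => \int[leb]_(u in `[s, +oo[) J alpha f (w, u)).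
Proof.
have := @measurable_fun_fubini_tonelli_F _ _ _ _ _ leb _
  (measurable_path_density_after alpha s) _.
rewrite /fubini_F; set h := (X in (_ -> measurable_fun _ X) -> _).
have -> : (fun w => \int[leb]_(u in `[s, +oo[) J alpha f (w, u)) = h.
  apply/funext => w; rewrite integral_mkcond; apply: eq_integral => u _.
  rewrite !patchE; congr (if _ then _ else _).
  by apply/idP/idP; rewrite !inE => //-[].
by apply=> z; apply: erestrict_ge0 => ? _; exact: path_density_ge0.
Qed.

(** The exponential and, by [alive_shift], the survival indicator factor at time [s]; the factor in
    front undoes the discount up to [s]. A path not alive at [s] contributes nothing to the
    right-hand side. *)
Lemma occupation_markov (alpha s : R) x : (0 <= s)%R ->
  \int[P x]_(w in [set w | alive D s w]) \int[occupation D P alpha (w s)]_y f y =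
  (expR (alpha * s))%:E * \int[P x]_w \int[leb]_(u in `[s, +oo[) J alpha f (w, u).
Proof.
move=> s0; under eq_integral do rewrite integral_occupation//.
have mY := measurable_path_integral D mf f0 alpha.
rewrite markov_functional//; last 2 first.
- exact: adapted_alive.
- by move=> w; apply: integral_ge0 => u _; exact: path_density_ge0.
rewrite -ge0_integralZl//; last 2 first.
- exact: measurable_path_integral_after.
- by move=> w _; apply: integral_ge0 => u _; exact: path_density_ge0.
rewrite integral_mkcond; apply: eq_integral => w _.
have mJw : measurable_fun setT (fun u : R => J alpha f (w, u)).
  apply: (measurableT_comp (measurable_path_density D alpha mf)).
  exact: pair1_measurable.
have mJs : measurable_fun setT (fun u : R => J alpha f (w, (s + u)%R)).
  by apply: (measurableT_comp mJw); exact: measurable_funD.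
have J0 u : 0 <= J alpha f (w, u) by exact: path_density_ge0.
rewrite integral_lebesgue_shift// -ge0_integralZl//; last first.
  exact: measurable_funTS.
rewrite patchE; case: ifPn => [|ws]; last first.
  apply/esym/integral0_eq => t; rewrite /= in_itv/= andbT => t0.
  rewrite /path_density /discount indicE memNset ?mulr0 ?mul0e ?mule0//= => -[_ wst].
  by move: ws; rewrite notin_setE; apply; apply: alive_le wst; rewrite lerDl.
rewrite inE => ws; rewrite [RHS]integral_mkcond; apply: eq_integral => t _.
rewrite patchE; case: ifPn => [|]; last first.
  rewrite notin_setE/= in_itv/= andbT => t0.
  by rewrite path_density_lt0// ltNge; exact/negP.
rewrite inE/= in_itv/= andbT => t0.
have -> : J alpha f (shift_path s w, t) =
    (discount D alpha (shift_path s w, t))%:E * f (w (s + t)%R).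
  by rewrite -(shift_pathE s w t0).
rewrite [J alpha f (w, _)]/path_density muleA -EFinM; congr (_%:E * _).
rewrite /discount.
rewrite mulrA -expRD; congr (expR _ * _)%R; first by rewrite /=; ring.
rewrite !indicE.
have -> : ((shift_path s w, t) \in alive_times D) = ((w, (s + t)%R) \in alive_times D); last by [].
apply/idP/idP.
  move=> /set_mem -[/= _ wt]. apply/mem_set; split; [by rewrite /= addr_ge0|].
  by apply/(alive_shift D w s0 t0); split.
move=> /set_mem -[/= _ /(alive_shift D w s0 t0) -[_ wt]].
by apply/mem_set; split.
Qed.

Lemma occupation_markov_le (alpha s : R) x : (0 <= s)%R ->
  \int[P x]_(w in [set w | alive D s w]) \int[occupation D P alpha (w s)]_y f y <=
  (expR (alpha * s))%:E * \int[occupation D P alpha x]_y f y.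
Proof.
move=> s0; rewrite occupation_markov// lee_wpmul2l ?lee_fin ?expR_ge0//.
rewrite integral_occupation//; apply: le_inner_integral => w _.
  by apply: integral_ge0 => u _; exact: path_density_ge0.
rewrite integral_mkcond; apply: le_inner_integral => u _.
  by apply: erestrict_ge0 => ? _; exact: path_density_ge0.
by rewrite patchE; case: ifP => // _; exact: path_density_ge0.
Qed.

(** At time [s] the inner occupation has grown by at most exp(alpha s), which leaves exp(-s), of
    integral 1. *)
Lemma occupation_iterate_le (alpha : R) x :
  \int[occupation D P (alpha + 1) x]_y \int[occupation D P alpha y]_z f z <=
  \int[occupation D P alpha x]_z f z.
Proof.
have mU := measurable_integral_occupation D P mf f0 alpha.
have U0 y : 0 <= \int[occupation D P alpha y]_z f z by exact: integral_ge0.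
rewrite integral_occupation_swap//; set c := \int[occupation _ _ _ x]_z f z.
have c0 : 0 <= c by exact: U0.
have me : measurable_fun setT (fun s : R => (expR (- 1 * s))%:E).
  by apply/measurable_EFinP/measurableT_comp => //; exact: measurable_funM.
apply: (@le_trans _ _ (\int[leb]_(s in `[0%R, +oo[) ((expR (- 1 * s))%:E * c))).
  rewrite [leRHS]integral_mkcond; apply: le_inner_integral => s _.
    by apply: integral_ge0 => w _; exact: path_density_ge0.
  rewrite patchE; case: ifPn; last first.
    rewrite notin_setE/= in_itv/= andbT => s0.
    by rewrite integral0_eq// => w _; rewrite path_density_lt0// ltNge; exact/negP.
  rewrite inE/= in_itv/= andbT => s0.
  have -> : (expR (- 1 * s))%:E * c =
      (expR (- (alpha + 1) * s))%:E * ((expR (alpha * s))%:E * c).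
    by rewrite muleA -EFinM -expRD; congr ((expR _)%:E * _); ring.
  have e0 : 0 <= (expR (- (alpha + 1) * s))%:E by rewrite lee_fin expR_ge0.
  apply: le_trans (lee_wpmul2l e0 (occupation_markov_le alpha x s0)).
  by rewrite (integral_path_density D P mU U0).
rewrite ge0_integralZr//; last exact: (measurable_funTS me).
by rewrite integral_expR_tail// invr1 mul1e.
Qed.

Lemma occupation_le_discount (alpha beta : R) x : (alpha <= beta)%R ->
  \int[occupation D P beta x]_y f y <= \int[occupation D P alpha x]_y f y.
Proof.
move=> ab.
rewrite (integral_occupation D P mf f0 beta) (integral_occupation D P mf f0 alpha).
apply: le_inner_integral => w _.
  by apply: integral_ge0 => u _; exact: path_density_ge0.
apply: le_inner_integral => u _; first exact: path_density_ge0.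
rewrite /path_density lee_wpmul2r// lee_fin /discount !indicE/=.
have [|_] := boolP ((w, u) \in _); last by rewrite !mulr0.
by rewrite inE => -[/= u0 _]; rewrite !mulr1 ler_expR !mulNr lerN2 ler_wpM2r.
Qed.

End occupation_markov.

(** * The resolvent, its null sets and its excessive functions *)

Section resolvent_occupation.
Local Open Scope ereal_scope.
Context {R : realType} {d : nat}.
Local Notation E := 'rV[R]_d.
Local Notation Omega := (cadlag_path R d).
Local Notation leb := (@lebesgue_measure R).
Variables (Q : E -> 'M[R]_d) (b : E -> E) (N : R.-sigmafker E ~> E).
Hypotheses (A1 : bounded_coefficients Q b) (A2 : bounded_levy_kernel N).
Variable P : R.-pker E ~> Omega.
Hypothesis A4 : strong_markov_solution (levy_operator Q b N) P.
Variable D : set E.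
Hypothesis oD : open D.
Local Notation occ := (occupation D P).

Lemma measurable_patch_Bb_plus (f : E -> R) : Bb_plus D f ->
  measurable_fun setT ((EFin \o f) \_ D).
Proof.
move=> [mf _ _]; have mD := open_measurable_rV oD.
have mf' : measurable_fun D (EFin \o f) by exact/measurable_EFinP.
exact: (measurable_restrictT _ mD).1 mf'.
Qed.

Lemma patch_Bb_plus_ge0 (f : E -> R) : Bb_plus D f ->
  forall y, 0 <= ((EFin \o f) \_ D) y.
Proof. by move=> [_ f0 _] y; apply: erestrict_ge0 => z Dz; rewrite lee_fin f0. Qed.

Lemma resolventE (f : E -> R) (alpha : R) (x : E) : Bb_plus D f -> D x ->
  resolvent D P alpha f x = \int[occ alpha x]_y ((EFin \o f) \_ D) y.
Proof.
move=> Bf Dx; have [mf f0 _] := Bf.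
rewrite (integral_occupation_swap D P (measurable_patch_Bb_plus Bf) (patch_Bb_plus_ge0 Bf)).
rewrite /resolvent integral_mkcond; apply: eq_integral => t _; rewrite patchE.
case: ifPn => [|]; last first.
  rewrite notin_setE/= in_itv/= andbT => t0.
  by rewrite integral0_eq// => w _; rewrite path_density_lt0// ltNge; exact/negP.
rewrite inE/= in_itv/= andbT => t0.
rewrite (integral_path_density D P (measurable_patch_Bb_plus Bf) (patch_Bb_plus_ge0 Bf))//.
rewrite (killed_semigroupE A1 A2 A4 oD)//; congr (_ * _).
apply: eq_integral => w; rewrite inE => wt.
by rewrite patchE mem_set//; exact: alive_mem wt.
Qed.

(** Two discounts vanish at the same pairs of path and time, namely off [alive_times], so the
    integrands vanish almost everywhere together. *)
Lemma occupation_eq0 (alpha beta : R) (x : E) (B : set E) : measurable B ->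
  occ alpha x B = 0 -> occ beta x B = 0.
Proof.
move=> mB; pose h a (z : Omega * R) : \bar R := (discount D a z * \1_B (z.1 z.2))%:E.
have h0 a z : 0 <= h a z by rewrite lee_fin mulr_ge0// discount_ge0.
have mh a : measurable_fun setT (h a).
  have mh : measurable_fun setT (fun z : Omega * R => discount D a z * \1_B (z.1 z.2))%R.
    apply: measurable_funM; first exact: measurable_discount.
    exact: (measurableT_comp (measurable_indic mB) measurable_path_eval).
  exact/measurable_EFinP.
have hE a : occ a x B = \int[kernel_law P x \x leb]_z `|h a z|.
  rewrite [LHS]weighted_imageE; apply: eq_integral => z _.
  by rewrite gee0_abs.
rewrite !hE => h_eq0.
have {}h_eq0 := (ae_eq_integral_abs (kernel_law P x \x leb) measurableT (mh alpha)).1 h_eq0.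
apply: (ae_eq_integral_abs (kernel_law P x \x leb) measurableT (mh beta)).2.
apply: filterS h_eq0 => z + _ => /(_ Logic.I)[] /eqP.
rewrite /h /discount mulf_eq0 mulf_eq0 gt_eqF ?expR_gt0//= => /orP[]/eqP ->.
  by rewrite mulr0 mul0r.
by rewrite mulr0.
Qed.

(** The time spent in [A] before [t] is at most [t], and the rest is bounded by the Markov property.
    This is the lower half of the squeeze in [excessive_occupation]. *)
Lemma occupation_ge_after (alpha t : R) (x : E) (A : set E) : (0 < alpha)%R -> (0 <= t)%R ->
  measurable A -> occ alpha x A <=
  \int[P x]_(w in [set w | alive D t w]) occ alpha (w t) A + t%:E.
Proof.
move=> a0 t0 mA; pose f := EFin \o (\1_A : E -> R).
have mf : measurable_fun setT f by exact/measurable_EFinP/measurable_indic.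
have f0 y : 0 <= f y by rewrite lee_fin.
have fE y : occ alpha y A = \int[occ alpha y]_z f z by rewrite integral_indic// setIT.
under eq_integral do rewrite fE.
rewrite fE (occupation_markov (solution_strong_markov A4) D mf f0)//.
have J0 z : 0 <= path_density D alpha f z by exact: path_density_ge0.
have mI := measurable_path_integral_after D mf f0 alpha t.
have I0 (w : Omega) : 0 <= \int[leb]_(u in `[t, +oo[) path_density D alpha f (w, u).
  by exact: integral_ge0.
apply: (@le_trans _ _ (\int[P x]_w
    \int[leb]_(u in `[t, +oo[) path_density D alpha f (w, u) + t%:E)); last first.
  rewrite leeD2r// -[leLHS]mul1e lee_wpmul2r ?integral_ge0// lee_fin.
  by rewrite -expR0 ler_expR mulr_ge0// ltW.
rewrite (integral_occupation D P mf f0).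
have -> : t%:E = \int[P x]_w cst t%:E w by rewrite integral_cst// prob_kernel mule1.
rewrite -ge0_integralD//; apply: le_inner_integral => w _; first exact: integral_ge0.
have -> : cst t%:E w = \int[leb]_u (\1_(`[0%R, t[%classic) u)%:E.
  rewrite integral_indic ?setIT//= lebesgue_measure_itv/= lte_fin.
  have [_|t_le0] := ltP 0%R t; first by rewrite sube0.
  by congr _%:E; apply/eqP; rewrite eq_le t0 t_le0.
have mJw : measurable_fun setT (fun u : R => path_density D alpha f (w, u)).
  apply: (measurableT_comp (measurable_path_density D alpha mf)).
  exact: pair1_measurable.
rewrite [in leRHS]integral_mkcond -ge0_integralD//; last 3 first.
- by move=> u _; apply: erestrict_ge0.
- by apply: (measurable_restrictT _ _).1 => //; exact: measurable_funTS.
- by apply/measurable_EFinP/measurable_indic.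
apply: le_inner_integral => u _ //; rewrite patchE; case: ifPn => [_|].
  by rewrite leeDl// lee_fin.
rewrite notin_setE/= in_itv/= andbT => /negP; rewrite -ltNge => ut.
rewrite add0e; have [u0|u0] := ltP u 0%R; first by rewrite path_density_lt0// lee_fin.
rewrite [in leRHS]indicE mem_set/= ?in_itv/= ?u0//.
rewrite /path_density -EFinM lee_fin /discount !indicE mulr_ile1//.
  rewrite mulr_ile1 ?expR_ge0 ?lern1 ?leq_b1//.
  by rewrite -expR0 ler_expR /= mulNr oppr_le0 mulr_ge0// ltW.
by rewrite lern1 leq_b1.
Qed.

Lemma occupation_fin_num (alpha : R) (x : E) (A : set E) : (0 < alpha)%R ->
  measurable A -> occ alpha x A \is a fin_num.
Proof.
by move=> a0 mA; rewrite ge0_fin_numE// (le_lt_trans (occupation_le D P x a0 mA))// ltry.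
Qed.

Lemma excessive_occupation (alpha : R) (A : set E) : (0 < alpha)%R -> measurable A ->
  excessive D P alpha (fun x => fine (occ alpha x A)).
Proof.
move=> a0 mA; pose psi x := fine (occ alpha x A); pose f := EFin \o (\1_A : E -> R).
have mf : measurable_fun setT f by exact/measurable_EFinP/measurable_indic.
have f0 y : 0 <= f y by rewrite lee_fin.
have fE y : occ alpha y A = \int[occ alpha y]_z f z by rewrite integral_indic// setIT.
have mpsi : measurable_fun D psi.
  apply: measurable_funTS; apply: measurableT_comp => //.
  exact: measurable_occupation.
have psi0 y : (0 <= psi y)%R by exact: fine_ge0.
have psiE y : (psi y)%:E = occ alpha y A by rewrite fineK// occupation_fin_num.
have KE (t : R) x : (0 <= t)%R -> D x -> killed_semigroup D P t psi x =
    \int[P x]_(w in [set w | alive D t w]) occ alpha (w t) A.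
  move=> t0 Dx; rewrite (killed_semigroupE A1 A2 A4 oD)//.
  by apply: eq_integral => w _; rewrite psiE.
have K_le (t : R) x : (0 <= t)%R -> D x ->
    killed_semigroup D P t psi x <= (expR (alpha * t) * psi x)%:E.
  move=> t0 Dx; rewrite KE// EFinM psiE fE; under eq_integral do rewrite fE.
  exact: (occupation_markov_le (solution_strong_markov A4) D mf f0).
split => [//|y _|t x t0 Dx|x Dx]; [exact: psi0|exact: K_le|].
apply: (squeeze_cvge (f := fun t => (psi x - t)%:E)
  (h := fun t => (expR (alpha * t) * psi x)%:E)).
- near=> t; have t0 : (0 <= t)%R by near: t; exact: nbhs_right_ge.
  rewrite K_le// andbT EFinB leeBlDr// psiE KE//.
  exact: occupation_ge_after.
- apply: cvg_EFin; first by near=> t.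
  rewrite -[X in _ --> X]subr0; apply: cvg_at_right_filter.
  by apply: cvgB; [exact: cvg_cst|exact: cvg_id].
- apply: cvg_EFin; first by near=> t.
  have : (expR (alpha * t) * psi x)%R @[t --> 0%R^'+] --> (expR (alpha * 0) * psi x)%R.
    apply: cvg_at_right_filter; apply: cvgMl.
    apply: (@cvg_comp _ _ _ (fun t => alpha * t)%R expR); last exact: continuous_expR.
    by apply: cvgMr; exact: cvg_id.
  by rewrite mulr0 expR0 mul1r.
Unshelve. all: by end_near. Qed.

End resolvent_occupation.

(** * Minorization *)

Section probability_dominated.
Local Open Scope ereal_scope.
Context d (T : measurableType d) (R : realType).

Lemma probability_dominated (m : {measure set T -> \bar R}) :
  sigma_finite setT m -> m setT != 0 ->
  exists P : probability T R, forall B, measurable B -> m B = 0 -> P B = 0.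
Proof.
move=> [F FT Ffin] mT0; have mF n : measurable (F n) by case: (Ffin n).
have [n mFn0] : exists n, m (F n) != 0.
  apply: contrapT => /forallNP mF0; move/eqP : mT0; apply.
  rewrite FT; apply: measure_negligible; first exact: bigcupT_measurable.
  apply: negligible_bigcup => k; apply/negligibleP => //.
  by apply/eqP/negPn/negP; exact: mF0.
(* The Dirac mass is the default of [mnormalize] for total mass 0 or infinity; [F n] has neither. *)
exists (mnormalize (mrestr m (mF n)) (\d_point : probability T R)) => B mB mB0.
have mBF : m (B `&` F n) = 0.
  apply/eqP; rewrite -measure_le0 -mB0; apply: le_measure; rewrite ?inE//.
  exact: measurableI.
rewrite /= /mnormalize/= /mrestr setTI; case: ifPn => [|_]; last by rewrite mBF mul0e.
by rewrite (negbTE mFn0)/= => /eqP Fy; have [_] := Ffin n; rewrite Fy.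
Qed.

End probability_dominated.

Section occupation_kernel.
Local Open Scope ereal_scope.
Context {R : realType} {d : nat}.
Local Notation E := 'rV[R]_d.
Variables (D : set E) (P : R.-pker E ~> cadlag_path R d) (alpha : R).

Definition occupation_kernel of (0 < alpha)%R : E -> {measure set E -> \bar R} :=
  fun x => occupation D P alpha x.

Variable alpha_gt0 : (0 < alpha)%R.
Local Notation K := (occupation_kernel alpha_gt0).

Let measurable_occupation_kernel U : measurable U -> measurable_fun setT (K ^~ U).
Proof. exact: measurable_occupation. Qed.

HB.instance Definition _ := isKernel.Build _ _ _ _ R K measurable_occupation_kernel.

Let occupation_kernel_uub : measure_fam_uub K.
Proof.
(* The added 1 makes the bound strict, as [measure_fam_uub] requires. *)
exists (alpha^-1 + 1)%R => x; apply: le_lt_trans (occupation_le D P x alpha_gt0 measurableT) _.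
by rewrite lte_fin ltrDl.
Qed.

HB.instance Definition _ := Kernel_isFinite.Build _ _ _ _ R K occupation_kernel_uub.

End occupation_kernel.

Section small_set_minorization.
Local Open Scope ereal_scope.
Context {R : realType} {d : nat}.
Local Notation E := 'rV[R]_d.
Variable P : R.-pker E ~> cadlag_path R d.
Hypothesis SM : strong_markov P.
Variables (D : set E) (alpha : R).
Hypothesis beta_gt0 : (0 < alpha + 1)%R.
Local Notation K := (occupation_kernel D P beta_gt0).
Variables (nu0 : {measure set E -> \bar R}) (A : set E).
Variable mK : forall B, measurable B -> measurable_fun [set: E] (K ^~ B).
Hypothesis mA : measurable A.
Hypothesis small : forall y B, A y -> measurable B -> nu0 B <= \int[K y]_z K z B.

Lemma small_set_minorization (f : E -> \bar R) (x : E) :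
  measurable_fun setT f -> (forall y, 0 <= f y) ->
  K x A * \int[mixture nu0 mK]_y f y <= \int[occupation D P alpha x]_y f y.
Proof.
move=> mf f0; pose U a (h : E -> \bar R) y := \int[occupation D P a y]_z h z.
have U0 a h y : (forall z, 0 <= h z) -> 0 <= U a h y by move=> h0; exact: integral_ge0.
have mU a h : measurable_fun setT h -> (forall z, 0 <= h z) -> measurable_fun setT (U a h).
  by move=> mh h0; exact: measurable_integral_occupation.
have U_le a g h y : (forall z, 0 <= g z) -> (forall z, g z <= h z) -> U a g y <= U a h y.
  by move=> g0 gh; apply: le_inner_integral => z _; [exact: g0|exact: gh].
pose V := U (alpha + 1)%R.
have V_le g y : measurable_fun setT g -> (forall z, 0 <= g z) ->
    V (U alpha g) y <= U alpha g y.
  by move=> mg g0; exact: occupation_iterate_le.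
have Vf_le y : V f y <= U alpha f y.
  by apply: occupation_le_discount => //; rewrite lerDl.
have Vf0 y : 0 <= V f y by exact: U0.
have mVf : measurable_fun setT (V f) by exact: mU.
have VVf0 y : 0 <= V (V f) y by exact: U0.
have VVVf0 y : 0 <= V (V (V f)) y by exact: U0.
pose C := \int[mixture nu0 mK]_y f y.
have C0 : 0 <= C by exact: integral_ge0.
(* [C] is the integral of [V f] against [nu0], and on [A] the measure [nu0] is below the kernel
   composed with itself. *)
have C_le y : A y -> C <= V (V (V f)) y.
  move=> Ay; rewrite /C [leLHS]integral_mixture//.
  have -> : V (V (V f)) y = \int[mixture (K y) mK]_z V f z by rewrite [RHS]integral_mixture.
  by apply: ge0_le_measure_integral => // B mB; exact: small.
apply: (@le_trans _ _ (V (V (V (V f))) x)).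
  have <- : \int[K x]_y ((\1_A y)%:E * C) = K x A * C.
    rewrite ge0_integralZr//; first by rewrite integral_indic// setIT.
    exact/measurable_EFinP/measurable_indic.
  apply: le_inner_integral => y _; first by rewrite mule_ge0// lee_fin.
  rewrite indicE; have [|_] := boolP (y \in A); last by rewrite mul0e; exact: U0.
  by rewrite inE mul1e; exact: C_le.
have VUf0 y : 0 <= V (U alpha f) y by exact: U0 _ _ _ (fun z => U0 _ _ z f0).
(* The first [V f] is bounded by [U alpha f], and each further [V] is then absorbed by [V_le]. *)
have le1 y : V (V f) y <= U alpha f y.
  exact: le_trans (U_le (alpha + 1)%R _ _ y Vf0 Vf_le) (V_le f y mf f0).
have le2 y : V (V (V f)) y <= V (U alpha f) y := U_le (alpha + 1)%R _ _ y VVf0 le1.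
apply: (le_trans (U_le (alpha + 1)%R _ _ x VVVf0 le2)).
apply: le_trans (V_le f x mf f0).
exact: U_le (alpha + 1)%R _ _ x VUf0 (fun y => V_le f y mf f0).
Qed.

End small_set_minorization.

Lemma measure_setI_conull d (T : measurableType d) (R : realType)
    (mu : {measure set T -> \bar R}) (B D : set T) :
  measurable B -> measurable D -> mu (~` D) = 0%E -> mu (B `&` D) = mu B.
Proof.
move=> mB mD muD; have mDC : measurable (~` D) by exact: measurableC.
have mBD : measurable (B `&` D) by exact: measurableI.
apply/eqP; rewrite eq_le; apply/andP; split; first by apply: le_measure; rewrite ?inE.
rewrite -[leRHS]adde0 -muD; apply: le_trans (measureU2 _ mBD mDC).
apply: le_measure; rewrite ?inE//; first exact: measurableU.
by move=> x Bx; have [Dx|Dx] := pselect (D x); [left|right].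
Qed.

Theorem theorem4p4 (R : realType) (d : nat)
    (D : set 'rV[R]_d) (Dopen : open D) (Dconn : connected D)
    (Q : 'rV[R]_d -> 'M[R]_d) (b : 'rV[R]_d -> 'rV[R]_d)
    (N : R.-sigmafker 'rV[R]_d ~> 'rV[R]_d)
    (A1 : bounded_coefficients Q b)
    (A2 : bounded_levy_kernel N)
    (P : R.-pker 'rV[R]_d ~> cadlag_path R d)
    (A4 : strong_markov_solution (levy_operator Q b N) P)
    (ET : forall x, D x -> {ae P x, forall w, (exit_time D w < +oo)%E})
    (m : {measure set 'rV[R]_d -> \bar R})
    (m_on_D : m (~` D) = 0%E)
    (m_sigma_finite : sigma_finite setT m)
    (m_nontrivial : m D != 0%E)
    (IRm : resolvent_irreducible D P m)
    (m_abs_cont : exists2 alpha : R, 0 <= alpha &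
       measure_resolvent D P m alpha `<< m) :
  forall alpha : R, 0 <= alpha ->
    exists (psi : 'rV[R]_d -> R) (nu : {measure set 'rV[R]_d -> \bar R}),
      [/\ (forall x, D x -> 0 < psi x) /\ excessive D P (alpha + 1) psi,
          nu (~` D) = 0%E /\ sigma_finite setT nu,
          m `<< nu &
          minorization D P alpha psi nu].
Proof.
move=> alpha alpha0; pose beta := alpha + 1.
have beta0 : 0 < beta by rewrite ltr_wpDl.
have mD := open_measurable_rV Dopen.
have mDC : measurable (~` D) by exact: measurableC.
have SM := solution_strong_markov A4.
pose K : R.-fker 'rV[R]_d ~> 'rV[R]_d := occupation_kernel D P beta0.
(* (IR_m) for the indicator of [B] gives positivity at rate 1, and [occupation_eq0] moves it to
   [beta]. *)
have K_pos y B : D y -> measurable B -> m B != 0%E -> (0 < K y B)%E.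
  move=> Dy mB mB0.
  have Bf : Bb_plus D (\1_B : 'rV[R]_d -> R).
    split; [exact: measurable_indic|by move=> x _; rewrite indicE|].
    by exists 1 => x _; rewrite indicE lern1 leq_b1.
  have mBD : (0 < \int[m]_(x in D) (\1_B x)%:E)%E.
    by rewrite integral_indic// measure_setI_conull// lt0e mB0 measure_ge0.
  have := IRm _ Bf mBD _ Dy; rewrite (resolventE A1 A2 A4 Dopen)//.
  rewrite !lt0e measure_ge0 andbT => /andP[+ _].
  apply: contra_neq => KB0; apply/eqP; rewrite eq_le integral_ge0 ?andbT; last first.
    by move=> z _; exact: patch_Bb_plus_ge0.
  rewrite -(occupation_eq0 (P := P) (D := D) 1 mB KB0).
  rewrite -[X in (_ <= occupation D P 1 y X)%E]setIT -integral_indic//.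
  apply: le_inner_integral => z _; first exact: patch_Bb_plus_ge0.
  by rewrite patchE; case: ifP => // _; rewrite lee_fin.
have mD0 : m setT != 0%E.
  apply: contra_neq m_nontrivial => mT0; apply/eqP; rewrite -measure_le0 -mT0.
  by apply: le_measure; rewrite ?inE.
have [p pm] := probability_dominated m_sigma_finite mD0.
have pD0 : p (~` D) = 0%E by exact: pm.
have pK : {ae p, forall x, p `<< K x}.
  exists (~` D); split => // x /=; apply: contra_not => Dx.
  apply/null_content_dominatesP => B mB KB0; apply: pm => //.
  by apply/eqP/negPn/negP => /(K_pos x B Dx mB); rewrite KB0 ltxx.
have [c [A [B0 [c0 [mA mB0] pA pB0 minor]]]] := small_set (@countable_rational_balls R d)
  (@setT_rational_balls R d) (@setI_rational_balls R d) (@rational_ballsE R d) pK.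
pose nu0 : {measure set 'rV[R]_d -> \bar R} := mscale (NngNum (ltW c0)) (mrestr p mB0).
have mK B : measurable B -> measurable_fun setT (K ^~ B) by move=> mB; exact: measurable_kernel.
pose nu : {measure set 'rV[R]_d -> \bar R} := mixture nu0 mK.
have nuE B : nu B = (\int[nu0]_x K x B)%E by [].
have nu0E B : nu0 B = (c%:E * p (B `&` B0))%E by [].
pose psi x := fine (K x A).
have psiE x : (psi x)%:E = K x A by rewrite fineK//; exact: (occupation_fin_num P D x beta0 mA).
have mA0 : m A != 0%E by apply: contraTneq pA => mA0; rewrite pm// ltxx.
exists psi, nu; split.
- split; last exact: (excessive_occupation A1 A2 A4 Dopen beta0 mA).
  by move=> x Dx; rewrite -lte_fin psiE K_pos.
- split.
    by rewrite nuE integral0_eq// => x _; exact: occupation_outside.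
  (* [nu] is even finite: its mass is at most [c / beta]. *)
  exists (fun=> setT); first by rewrite bigcup_const.
  move=> _; split => //.
  have : (nu setT <= \int[nu0]_x (beta^-1)%:E)%E.
    rewrite nuE; apply: ge0_le_integral => //; first exact: (mK _ measurableT).
    by move=> x _; exact: (occupation_le D P x beta0 measurableT).
  move=> /le_lt_trans; apply; rewrite integral_cst// nu0E setTI.
  rewrite !muleA -EFinM lte_mul_pinfty// ?lee_fin ?mulr_ge0 ?invr_ge0 ?ltW//.
  by rewrite (le_lt_trans (probability_le1 _ _))// ltry.
(* If [nu B] is 0, then [K x B] vanishes for [nu0]-almost every [x]. With [m B] nonzero it is
   positive on all of [D], so [D] would be [nu0]-null, against [p B0 > 0]. *)
- apply/null_content_dominatesP => B mB nuB0; apply/eqP/negPn/negP => mB_neq0.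
  have KB0 : ae_eq nu0 setT (K ^~ B) (cst 0%E).
    apply: (ae_eq_integral_abs nu0 measurableT (mK B mB)).1.
    by rewrite -[RHS]nuB0 -[RHS]/(\int[nu0]_x K x B)%E; apply: eq_integral => x _; rewrite gee0_abs.
  have : nu0 D = 0%E.
    apply: measure_negligible => //; apply: negligibleS KB0 => x Dx /=.
    by move=> /(_ Logic.I) KB0; have /gt_eqF/eqP := K_pos x B Dx mB mB_neq0.
  rewrite nu0E setIC measure_setI_conull// => /eqP.
  by rewrite mule_eq0 eqe !gt_eqF.
- move=> f x Bf Dx; rewrite (resolventE A1 A2 A4 Dopen)// psiE integral_mkcond.
  apply: (small_set_minorization SM) => //.
  + exact: measurable_patch_Bb_plus.
  + exact: patch_Bb_plus_ge0.
Qed.
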